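(* Suppose that $f:\mathbb{R}^d\to\mathbb{R}$ is bounded below by $f^*$ and twice continuously differentiable with $L_H$-Lipschitz continuous Hessian $\nabla^2f$, and let $\epsilon>0$. Consider the R-ARC algorithm of the context with $\mathcal{S}$ the distribution of scaled Gaussian matrices in $\mathbb{R}^{l\times d}$, and suppose that $\nabla^2f(x_k)$ has rank at most $r$ for all $k$. Choose $l=4C_l(\log16+r+1)$, where $C_l$ is the absolute constant given in the context, and put $$S_{max}=1+\frac{\sqrt d+\sqrt{2\log16}}{\sqrt{4C_l(\log16+r+1)}}.$$ Suppose that $\frac{c}{(c+1)^2}>\frac18$. Let $\alpha_{low}=\frac{2(1-\theta)}{L_H}$ and let $\tau_\alpha\in\mathbb{N}^+$ be such that $\alpha_{min}:=\alpha_0\gamma_1^{\tau_\alpha}$ satisfies $\alpha_{min}\le\alpha_{low}$ and $\alpha_{min}\le\alpha_0/\gamma_2$. Define $$h(\epsilon,\alpha)=\frac{\theta}{3\alpha_{\max}}\left(\frac\epsilon2\right)^{3/2}\min\left\{\frac{2^{3/2}}{L_H^{3/2}},\left(\frac{\sqrt{1/2}}{\frac1\alpha S_{max}+\kappa_T}\right)^{3/2}\right\}.$$ Then for any $\delta_1\in(0,1)$ with $g(\delta_1)>0$, where $$g(\delta_1)=\left[\tfrac78(1-\delta_1)-1+\frac{c}{(c+1)^2}\right]^{-1},$$ if the algorithm is run for $N\in\mathbb{N}$ iterations with $$N\ge g(\delta_1)\left[\frac{f(x_0)-f^*}{h(\epsilon,\alpha_0\gamma_1^{c+\tau_\alpha})}+\frac{\tau_\alpha}{1+c}\right],$$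 we have $$\mathbb{P}\left(\min_{k\le N}\|\nabla f(x_{k+1})\|_2\le\epsilon\right)\ge1-e^{-\frac{7\delta_1^2}{16}N}.$$
   Context: Scaled Gaussian matrix: $S\in\mathbb{R}^{l\times d}$ with independent $N(0,1/l)$ entries. Constant $C_l$: an absolute constant, provided by a known result, such that for any $\epsilon'\in(0,1)$, any fixed $d\times(d+1)$ matrix $M$ of rank at most $r+1$ and a scaled Gaussian matrix $S\in\mathbb{R}^{l\times d}$, with probability at least $1-e^{-l(\epsilon')^2/C_l+r+1}$ one has $\|SMz\|_2^2\ge(1-\epsilon')\|Mz\|_2^2$ for all $z\in\mathbb{R}^{d+1}$. The value $l$ is understood to be a positive integer. R-ARC (random subspace cubic regularisation) algorithm. Parameters: a distribution $\mathcal{S}$ of matrices in $\mathbb{R}^{l\times d}$, $\gamma_1\in(0,1)$, $\gamma_2=\gamma_1^{-c}$ for some $c\in\mathbb{N}^+$, $\theta\in(0,1)$, $\kappa_T\ge0$, $\alpha_{\max}>0$, deterministic $x_0\in\mathbb{R}^d$, $\alpha_0=\alpha_{\max}\gamma_1^p$ for some $p\in\mathbb{N}^+$. At each iteration $k=0,1,\dots$: 1. Draw $S_k$ from $\mathcal{S}$, independently of all previous iterations. For $\hat s\in\mathbb{R}^l$ let $\hat q_k(\hat s)=f(x_k)+\langle S_k\nabla f(x_k),\hat s\rangle+\frac12\langle\hat s,S_k\nabla^2f(x_k)S_k^T\hat s\rangle$ and $\hat m_k(\hat s)=\hat q_k(\hat s)+\frac1{3\alpha_k}\|S_k^T\hat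 s\|_2^3$. Compute $\hat s_k$ such that $\hat m_k(\hat s_k)\le\hat m_k(0)$ and $\|\nabla\hat m_k(\hat s_k)\|_2\le\kappa_T\|S_k^T\hat s_k\|_2^2$, and set $s_k=S_k^T\hat s_k$. 2. Sufficient decrease test: $f(x_k)-f(x_k+s_k)\ge\theta[\hat q_k(0)-\hat q_k(\hat s_k)]$. 3. If the test holds, set $x_{k+1}=x_k+s_k$, $\alpha_{k+1}=\min\{\alpha_{\max},\gamma_2\alpha_k\}$; otherwise $x_{k+1}=x_k$, $\alpha_{k+1}=\gamma_1\alpha_k$. *)

(* Defs.v *)
(* MathComp / MathComp-Analysis, over an arbitrary R : realType. *)
From HB Require Import structures.
From mathcomp Require Export all_boot all_order all_algebra.
From mathcomp Require Export all_classical all_reals all_analysis.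

Set Implicit Arguments.
Unset Strict Implicit.
Unset Printing Implicit Defensive.

Import Order.TTheory GRing.Theory Num.Theory.
Import numFieldNormedType.Exports.

Local Open Scope classical_set_scope.
Local Open Scope ring_scope.

Section Euclidean.
Context {R : realType}.

Definition dot {n : nat} (u v : 'cV[R]_n) : R := \sum_i u i 0 * v i 0.

(* The library norm on matrices is the max norm; 'enorm' is the 2-norm, and
   'opnorm' the operator norm it induces. *)
Definition enorm {n : nat} (v : 'cV[R]_n) : R := Num.sqrt (dot v v).

Definition opnorm {m n : nat} (A : 'M[R]_(m, n)) : R :=
  sup [set enorm (A *m z) | z in [set z : 'cV[R]_n | enorm z <= 1]].

Definition grad {n : nat} (f : 'cV[R]_n -> R) (x : 'cV[R]_n) : 'cV[R]_n :=
  \col_i 'D_(delta_mx i 0) (f : 'cV[R]_n -> R^o) x.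

Definition hess {n : nat} (f : 'cV[R]_n -> R) (x : 'cV[R]_n) : 'M[R]_n :=
  \matrix_(i, j) 'D_(delta_mx j 0) ((fun y => grad f y i 0) : 'cV[R]_n -> R^o) x.

Definition twice_continuously_differentiable {n : nat} (f : 'cV[R]_n -> R) : Prop :=
  [/\ forall x, differentiable (f : 'cV[R]_n -> R^o) x,
      forall x, differentiable (grad f) x
    & continuous (hess f)].

Definition lipschitz_hessian {n : nat} (f : 'cV[R]_n -> R) (LH : R) : Prop :=
  forall x y, opnorm (hess f x - hess f y) <= LH * enorm (x - y).

End Euclidean.

Section RandomMatrices.
Context {R : realType} {disp : measure_display} {T : measurableType disp}.
Variable P : probability T R.

Definition measurable_mx {m n : nat} (X : T -> 'M[R]_(m, n)) : Prop :=
  forall i j, measurable_fun [set: T] (fun w => X w i j).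

(* Generators of the sigma-algebra spanned by a random matrix. *)
Definition mx_events {m n : nat} (X : T -> 'M[R]_(m, n)) : set (set T) :=
  [set E | exists i j,
     preimage_set_system [set: T] (fun w => X w i j) measurable E].

Definition independent_sigma (F G : set (set T)) : Prop :=
  forall A B, <<s F >> A -> <<s G >> B -> P (A `&` B) = (P A * P B)%E.

(* Independent N(0, 1/l) entries: 'normal_prob' takes the standard deviation
   as its second argument, and mutual independence is the product rule over
   every subfamily J of the entries. *)
Definition scaled_gaussian {l d : nat} (S : T -> 'M[R]_(l, d)) : Prop :=
  [/\ measurable_mx S,
      forall i j (B : set R), measurable B ->
        pushforward P (fun w => S w i j) B
          = normal_prob 0 (Num.sqrt (l%:R^-1)) B
    & forall (J : {set 'I_l * 'I_d}) (B : 'I_l * 'I_d -> set R),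
        (forall ij, measurable (B ij)) ->
        P [set w | forall ij, ij \in J -> B ij (S w ij.1 ij.2)]
          = (\prod_(ij in J) P [set w | B ij (S w ij.1 ij.2)])%E].

End RandomMatrices.

(* C_l is absolute: the bound holds for every sample space, all dimensions l, d
   and every r, M, eps. *)
Definition gaussian_embedding_constant (R : realType) (Cl : R) : Prop :=
  0 < Cl /\
  forall (disp : measure_display) (T : measurableType disp) (P : probability T R)
    (l d r : nat) (S : T -> 'M[R]_(l, d)) (M : 'M[R]_(d, d.+1)) (eps : R),
  (0 < l)%N -> 0 < eps -> eps < 1 -> (\rank M <= r.+1)%N ->
  scaled_gaussian P S ->
  ((1 - expR (- (l%:R * eps ^+ 2 / Cl) + r%:R + 1))%:E <=
   P [set w | forall z : 'cV[R]_d.+1,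
        ((1 - eps) * enorm (M *m z) ^+ 2 <= enorm (S w *m M *m z) ^+ 2)%R])%E.

Section Algorithm.
Context {R : realType}.

Definition qhat {l d : nat} (f : 'cV[R]_d -> R) (x : 'cV[R]_d)
    (S : 'M[R]_(l, d)) (s : 'cV[R]_l) : R :=
  f x + dot (S *m grad f x) s + 2^-1 * dot s (S *m hess f x *m S^T *m s).

Definition mhat {l d : nat} (f : 'cV[R]_d -> R) (x : 'cV[R]_d) (alpha : R)
    (S : 'M[R]_(l, d)) (s : 'cV[R]_l) : R :=
  qhat f x S s + (3 * alpha)^-1 * enorm (S^T *m s) ^+ 3.

Definition sufficient_decrease {l d : nat} (f : 'cV[R]_d -> R) (theta : R)
    (x : 'cV[R]_d) (S : 'M[R]_(l, d)) (s : 'cV[R]_l) : bool :=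
  theta * (qhat f x S 0 - qhat f x S s) <= f x - f (x + S^T *m s).

(* The sequences (S, shat, x, alpha) are a realisation of the algorithm on the
   probability space (T, P).  The subproblem solver is only constrained by the
   two conditions on shat k, so shat k is any random vector satisfying them, and
   it may itself be randomised.  The past of iteration k is the sigma-algebra
   spanned by the S j and shat j with j < k; x k and alpha k are functions of
   these.  'has_law X' says that the random matrix X has distribution calS. *)
Record rarc_run {disp : measure_display} {T : measurableType disp}
    (P : probability T R) {l d : nat} (f : 'cV[R]_d -> R)
    (has_law : (T -> 'M[R]_(l, d)) -> Prop)
    (gamma1 gamma2 theta kappaT alphamax alpha0 : R) (x0 : 'cV[R]_d)
    (S : nat -> T -> 'M[R]_(l, d)) (shat : nat -> T -> 'cV[R]_l)
    (x : nat -> T -> 'cV[R]_d) (alpha : nat -> T -> R) : Prop := {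
  rarc_x0 : forall w, x 0%N w = x0;
  rarc_alpha0 : forall w, alpha 0%N w = alpha0;
  rarc_law : forall k, has_law (S k);
  rarc_measurable_S : forall k, measurable_mx (S k);
  rarc_measurable_shat : forall k, measurable_mx (shat k);
  rarc_independent : forall k,
    independent_sigma P (mx_events (S k))
      (\bigcup_(j in [set j | (j < k)%N])
         (mx_events (S j) `|` mx_events (shat j)));
  rarc_decrease : forall k w,
    mhat f (x k w) (alpha k w) (S k w) (shat k w)
      <= mhat f (x k w) (alpha k w) (S k w) 0;
  rarc_stationary : forall k w,
    enorm (grad (mhat f (x k w) (alpha k w) (S k w)) (shat k w))
      <= kappaT * enorm ((S k w)^T *m shat k w) ^+ 2;
  rarc_step_x : forall k w,
    x k.+1 w = if sufficient_decrease f theta (x k w) (S k w) (shat k w)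
               then x k w + (S k w)^T *m shat k w else x k w;
  rarc_step_alpha : forall k w,
    alpha k.+1 w = if sufficient_decrease f theta (x k w) (S k w) (shat k w)
                   then Num.min alphamax (gamma2 * alpha k w)
                   else gamma1 * alpha k w
}.

End Algorithm.

Section Constants.
Context {R : realType}.

Definition S_max (d r : nat) (Cl : R) : R :=
  1 + (Num.sqrt d%:R + Num.sqrt (2 * ln 16))
      / Num.sqrt (4 * Cl * (ln 16 + r%:R + 1)).

Definition h_rarc (theta alphamax LH Smax kappaT eps alpha : R) : R :=
  theta / (3 * alphamax) * (eps / 2) `^ (3 / 2)
  * Num.min (2 `^ (3 / 2) / LH `^ (3 / 2))
            ((Num.sqrt (1 / 2) / (1 / alpha * Smax + kappaT)) `^ (3 / 2)).

Definition g_rarc (c : nat) (delta1 : R) : R :=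
  (7 / 8 * (1 - delta1) - 1 + c%:R / (c%:R + 1) ^+ 2)^-1.

End Constants.

(* Main.v *)
(* The condition [m(shat) <= m(0)] alone gives a model decrease of at least
   |s|^3 / (3 alpha), so every iteration with alpha <= alpha_low is successful,
   whatever the sketch.  Hence alpha never drops below alpha_min, and at least
   (N - tau) / (1 + c) of the first N iterations are successful.  If the sketch
   is also good and the next gradient exceeds eps, the objective decreases by h.
   So it suffices that fewer than N (1/8 + 7/8 delta1) sketches are bad; given
   the past, a sketch is bad with probability at most 1/8, and a Chernoff bound
   concludes.

   A sketch is good when it embeds the range of [grad f | hess f] with
   distortion 1/2 (probability 15/16 by the choice of l) and has operator norm
   at most 2 S_max - 1 / sqrt 2.  The latter replaces the usual requirement
   |S| <= S_max: as L_H / 2 <= 1 / alpha_min, the two cases in the definition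
   of h leave that much room.  It is then enough to have the norm bound
   sqrt (3/2) (1 + sqrt (2 ln 16 / l + 8 d / (3 l))), which holds with
   probability 15/16 by a union bound over a grid of mesh sqrt (2 / d) in which
   the point z has weight proportional to 2^(-|z|^2), followed by rounding. *)
Require Import Defs.
From HB Require Import structures.
From mathcomp Require Import all_boot all_order all_algebra.
From mathcomp Require Import all_classical all_reals all_analysis.
From mathcomp Require Import measurable_realfun.
From mathcomp Require Import zify ring lra.
Import Order.TTheory GRing.Theory Num.Theory.
Import numFieldNormedType.Exports.
Local Open Scope classical_set_scope.
Local Open Scope ring_scope.
Set Implicit Arguments.
Unset Strict Implicit.
Unset Printing Implicit Defensive.

(** The step depends on the sketch, so a good sketch must be defined by the sketch and the current
    iterate alone, uniformly over all steps; this is why the embedding is asked on a whole range.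
    The iterate is random but determined by the past. Instead of conditional probabilities, the pair
    formed by the past and the new sketch is given its product law and the iterate is frozen. This
    requires the good event to be jointly measurable although it quantifies over uncountably many
    vectors, hence the approximation by rational vectors. The norm constants come from the following
    budget. The embedding loses a factor [sqrt 2], which turns [sqrt (3/2)] into [sqrt 3]. The
    result fits below [2 * sqrt 2 * S_max - 1] because [1 + sqrt 3 <= 2 * sqrt 2] and
    [sqrt 3 * sqrt (8/3) = 2 * sqrt 2]. So [8/3] is the largest coefficient of [d / l] that can be
    afforded, and the grid must cost less: its mesh and the base 2 of its weights lead to the cost
    [2 * ln (43/20) + 3/2 * ln 2], which is below [8/3]. *)

Section Euclidean.
Context {R : realType}.
Implicit Types (n m : nat).

(** * Inner products, the 2-norm and the operator norm *)

Lemma dotC n (u v : 'cV[R]_n) : dot u v = dot v u.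
Proof. by apply: eq_bigr => i _; rewrite mulrC. Qed.

Lemma dotDl n (u v w : 'cV[R]_n) : dot (u + v) w = dot u w + dot v w.
Proof. by rewrite /dot -big_split; apply: eq_bigr => i _; rewrite mxE mulrDl. Qed.

Lemma dotZl n (a : R) (u v : 'cV[R]_n) : dot (a *: u) v = a * dot u v.
Proof. by rewrite /dot mulr_sumr; apply: eq_bigr => i _; rewrite mxE mulrA. Qed.

Lemma dotDr n (u v w : 'cV[R]_n) : dot u (v + w) = dot u v + dot u w.
Proof. by rewrite dotC dotDl !(dotC u). Qed.

Lemma dotZr n (a : R) (u v : 'cV[R]_n) : dot u (a *: v) = a * dot u v.
Proof. by rewrite dotC dotZl dotC. Qed.

Lemma dot0l n (u : 'cV[R]_n) : dot 0 u = 0.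
Proof. by rewrite -(scale0r u) dotZl mul0r. Qed.

Lemma dot0r n (u : 'cV[R]_n) : dot u 0 = 0.
Proof. by rewrite dotC dot0l. Qed.

Lemma dotNl n (u v : 'cV[R]_n) : dot (- u) v = - dot u v.
Proof. by rewrite -scaleN1r dotZl mulN1r. Qed.

Lemma dotNr n (u v : 'cV[R]_n) : dot u (- v) = - dot u v.
Proof. by rewrite dotC dotNl dotC. Qed.

Lemma dotBl n (u v w : 'cV[R]_n) : dot (u - v) w = dot u w - dot v w.
Proof. by rewrite dotDl dotNl. Qed.

Lemma dotBr n (u v w : 'cV[R]_n) : dot u (v - w) = dot u v - dot u w.
Proof. by rewrite dotDr dotNr. Qed.

Lemma dot_mulmx m n (A : 'M[R]_(m, n)) (u : 'cV[R]_n) (v : 'cV[R]_m) :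
  dot (A *m u) v = dot u (A^T *m v).
Proof.
rewrite /dot; under eq_bigr do rewrite mxE mulr_suml.
rewrite exchange_big /=; apply: eq_bigr => j _; rewrite mxE mulr_sumr.
by apply: eq_bigr => i _; rewrite mxE; ring.
Qed.

Lemma dot_delta n (u : 'cV[R]_n) i : dot u (delta_mx i 0) = u i 0.
Proof.
rewrite /dot (bigD1 i)//= mxE !eqxx mulr1 big1 ?addr0// => j /negbTE ji.
by rewrite mxE ji mulr0.
Qed.

Lemma dot_ge0 n (u : 'cV[R]_n) : 0 <= dot u u.
Proof. by apply: sumr_ge0 => i _; rewrite -expr2 sqr_ge0. Qed.

Lemma enorm_ge0 n (u : 'cV[R]_n) : 0 <= enorm u.
Proof. exact: sqrtr_ge0. Qed.

Lemma enorm_sqr n (u : 'cV[R]_n) : enorm u ^+ 2 = dot u u.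
Proof. by rewrite sqr_sqrtr// dot_ge0. Qed.

Lemma enormZ n (a : R) (u : 'cV[R]_n) : enorm (a *: u) = `|a| * enorm u.
Proof.
by rewrite /enorm dotZl dotZr mulrA -expr2 sqrtrM ?sqr_ge0// sqrtr_sqr.
Qed.

Lemma enorm0 n : enorm (0 : 'cV[R]_n) = 0.
Proof. by rewrite /enorm dot0l sqrtr0. Qed.

Lemma enorm_eq0 n (u : 'cV[R]_n) : enorm u = 0 -> u = 0.
Proof.
move=> u0; have : dot u u = 0 by rewrite -enorm_sqr u0 expr0n.
move/eqP; rewrite psumr_eq0; last by move=> i _; rewrite -expr2 sqr_ge0.
move=> /allP h; apply/matrixP => i j; rewrite !mxE (ord1 j).
have := h i; rewrite mem_index_enum => /(_ isT) /=.
by rewrite mulf_eq0 orbb => /eqP.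
Qed.

Lemma enormN n (u : 'cV[R]_n) : enorm (- u) = enorm u.
Proof. by rewrite -scaleN1r enormZ normrN1 mul1r. Qed.

Lemma cauchy_schwarz n (u v : 'cV[R]_n) : dot u v <= enorm u * enorm v.
Proof.
have [/enorm_eq0 ->|u0] := eqVneq (enorm u) 0; first by rewrite dot0l enorm0 mul0r.
have [/enorm_eq0 ->|v0] := eqVneq (enorm v) 0; first by rewrite dot0r enorm0 mulr0.
have up : 0 < enorm u by rewrite lt_def u0 enorm_ge0.
have vp : 0 < enorm v by rewrite lt_def v0 enorm_ge0.
have := dot_ge0 (enorm v *: u - enorm u *: v).
rewrite dotBl !dotBr !dotZl !dotZr -!enorm_sqr (dotC v u) => h.
have : 0 <= 2 * (enorm u * enorm v) * (enorm u * enorm v - dot u v) by nra.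
by rewrite pmulr_rge0 ?subr_ge0// !mulr_gt0.
Qed.

Lemma cauchy_schwarz_norm n (u v : 'cV[R]_n) : `|dot u v| <= enorm u * enorm v.
Proof.
rewrite ler_norml cauchy_schwarz andbT lerNl -dotNl.
by rewrite (le_trans (cauchy_schwarz _ _))// enormN.
Qed.

Lemma enormD n (u v : 'cV[R]_n) : enorm (u + v) <= enorm u + enorm v.
Proof.
rewrite -(@ler_pXn2r _ 2) ?nnegrE ?addr_ge0 ?enorm_ge0//.
rewrite enorm_sqr dotDl !dotDr (dotC v u) sqrrD !enorm_sqr.
have := cauchy_schwarz u v; lra.
Qed.

Lemma enorm_le_dual n (u : 'cV[R]_n) (c : R) : 0 <= c ->
  (forall v, dot u v <= c * enorm v) -> enorm u <= c.
Proof.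
move=> c0 h; have := h u; rewrite -enorm_sqr expr2.
have := enorm_ge0 u; rewrite le_eqVlt => /orP[/eqP <-//|u0].
by rewrite ler_pM2r.
Qed.

(** A [sup] dominates the members of its set only if the set is bounded above; the Frobenius norm,
    obtained row by row from Cauchy-Schwarz, supplies the bound. *)
Lemma opnorm_ub m n (A : 'M[R]_(m, n)) (z : 'cV[R]_n) :
  enorm (A *m z) <= opnorm A * enorm z.
Proof.
have bnd (y : 'cV[R]_n) : enorm (A *m y) ^+ 2
    <= (\sum_i dot (row i A)^T (row i A)^T) * enorm y ^+ 2.
  rewrite enorm_sqr mulr_suml; apply: ler_sum => i _.
  have -> : (A *m y) i 0 = dot (row i A)^T y.
    by rewrite mxE; apply: eq_bigr => j _; rewrite !mxE.
  rewrite -expr2 -enorm_sqr -exprMn -real_normK ?num_real//.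
  by rewrite lerXn2r ?nnegrE// ?mulr_ge0 ?enorm_ge0// cauchy_schwarz_norm.
have F0 : 0 <= \sum_i dot (row i A)^T (row i A)^T.
  by apply: sumr_ge0 => i _; exact: dot_ge0.
have [/enorm_eq0 ->|z0] := eqVneq (enorm z) 0.
  by rewrite mulmx0 !enorm0 mulr0.
have zp : 0 < enorm z by rewrite lt_def z0 enorm_ge0.
rewrite -ler_pdivrMr//.
have -> : enorm (A *m z) / enorm z = enorm (A *m ((enorm z)^-1 *: z)).
  by rewrite -scalemxAr enormZ ger0_norm ?invr_ge0 ?enorm_ge0// mulrC.
apply: ub_le_sup; last first.
  exists ((enorm z)^-1 *: z) => //=.
  by rewrite enormZ ger0_norm ?invr_ge0 ?enorm_ge0// mulVf.
exists (Num.sqrt (\sum_i dot (row i A)^T (row i A)^T)) => _ [y /= y1 <-].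
rewrite -(@ler_pXn2r _ 2) ?nnegrE ?sqrtr_ge0 ?enorm_ge0// [leRHS]sqr_sqrtr//.
apply: (le_trans (bnd y)); rewrite ler_piMr//.
by rewrite exprn_ile1 ?enorm_ge0.
Qed.

End Euclidean.

(** * Directional derivatives and one-variable mean value bounds *)

Section Calculus.
Context {R : realType}.

Lemma is_derive_line n (F : 'cV[R]_n -> R^o) (x s : 'cV[R]_n) (t : R) :
  differentiable F (x + t *: s) ->
  is_derive t (1 : R) (fun t => F (x + t *: s))
    (\sum_i s i 0 * 'D_(delta_mx i 0) F (x + t *: s)).
Proof.
move=> dF; have dv : derivable F (x + t *: s) s by exact: diff_derivable.
have := derivableP dv.
have -> : 'D_s F (x + t *: s) = \sum_i s i 0 * 'D_(delta_mx i 0) F (x + t *: s).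
  rewrite deriveE//.
  have sE : s = \sum_i s i 0 *: delta_mx i 0.
    rewrite [LHS]matrix_sum_delta; apply: eq_bigr => i _.
    by rewrite big_ord_recl big_ord0 addr0.
  rewrite [X in 'd F _ X]sE linear_sum; apply: eq_bigr => i _.
  by rewrite linearZ /= deriveE.
move=> [dvF valF].
(* The two difference quotients are the same function of [h], so no chain rule is needed. *)
have e : (fun h : R => h^-1 *: (((fun t => F (x + t *: s)) \o shift t) (h *: (1 : R)) - F (x + t *: s))) =
    (fun h : R => h^-1 *: ((F \o shift (x + t *: s)) (h *: s) - F (x + t *: s))).
  apply/funext => h /=; congr (_ *: (F _ - _)).
  by rewrite [_ *: 1]mulr1 scalerDl addrCA.
by split; [rewrite /derivable e|rewrite /derive e].
Qed.

(** Integration without integrals: the cubic [q] is a primitive of the quadratic bound, so [q - g]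
    has nonnegative derivative for [t >= 0], and the mean value theorem compares its values at 0 and
    1. *)
Lemma quadratic_mean_value (g dg : R -> R) (c0 c1 c2 : R) :
  (forall t, is_derive t (1 : R) g (dg t)) ->
  (forall t, 0 <= t -> dg t <= c0 + c1 * t + c2 * t ^+ 2) ->
  g 1 - g 0 <= c0 + c1 / 2 + c2 / 3.
Proof.
move=> dgP dgle.
pose q : {poly R} := c0 *: 'X + (c1 / 2) *: 'X^2 + (c2 / 3) *: 'X^3.
pose u : R -> R := horner q - g.
have dq t : q^`().[t] = c0 + c1 * t + c2 * t ^+ 2.
  by rewrite /q !derivD !derivZ derivX !derivXn /= !hornerE /= ?hornerMn ?hornerXn; field.
have du t : is_derive t (1 : R) u (c0 + c1 * t + c2 * t ^+ 2 - dg t).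
  by rewrite -dq; exact: is_deriveB.
have cu : {within `[0, 1 : R], continuous u}.
  apply: continuous_subspaceT => t.
  apply: differentiable_continuous; apply/derivable1_diffP.
  exact: ex_derive.
have [c c01] := MVT ltr01 (fun t _ => du t) cu.
rewrite subr0 mulr1 => uE.
have c0' : 0 <= c by move: c01; rewrite in_itv/= => /andP[/ltW].
have := dgle c c0'.
move: uE; rewrite /u /q !fctE !hornerE /=; lra.
Qed.

(** Meant for the cubic term of the model: it yields the derivative from an estimate, without
    differentiating the norm, which is not differentiable at 0. *)
Lemma derive_of_quadratic_bound n (F : 'cV[R]_n -> R^o) (a v : 'cV[R]_n) (L C : R) :
  (forall t : R, `|t| <= 1 -> `|F (a + t *: v) - F a - t * L| <= C * t ^+ 2) ->
  'D_v F a = L.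
Proof.
move=> H; apply: cvg_lim => //; apply/cvgrPdist_lt => e e0.
have C0 : 0 <= C.
  by have := H 1; rewrite normr1 lexx expr1n mulr1 => /(_ isT); apply: le_trans.
have h0 : 0 < Num.min 1 (e / (C + 1)).
  by rewrite lt_min ltr01/= divr_gt0// ltr_wpDl.
near=> h.
have hn0 : h != 0 by near: h; exact: nbhs_dnbhs_neq.
have : `|h| < Num.min 1 (e / (C + 1)).
  near: h; apply: dnbhs0_lt => //.
rewrite lt_min => /andP[h1 he].
have := H h (ltW h1).
rewrite /= [h *: v + a]addrC => Hh.
have -> : L - h^-1 *: (F (a + h *: v) - F a) = - (h^-1 * (F (a + h *: v) - F a - h * L)).
  by rewrite mulrBr mulKf// opprB.
rewrite normrN normrM normfV.
rewrite ltr_pdivrMl ?normr_gt0//.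
apply: le_lt_trans Hh _; rewrite -[h ^+ 2]real_normK ?num_real// expr2 mulrA mulrC.
rewrite ltr_pM2l ?normr_gt0//.
have : `|h| * (C + 1) < e by rewrite -ltr_pdivlMr// ltr_wpDl.
have := normr_ge0 h; nra.
Unshelve. all: by end_near. Qed.

End Calculus.

(** * Taylor bounds from a Lipschitz Hessian, and symmetry of the Hessian *)

Section Taylor.
Context {R : realType} {n : nat}.
Variables (f : 'cV[R]_n -> R) (LH : R).
Hypothesis hf : twice_continuously_differentiable f.
Hypothesis hLip : lipschitz_hessian f LH.
Implicit Types x s u v : 'cV[R]_n.

Lemma is_derive_line_grad x s t :
  is_derive t (1 : R) (fun t => f (x + t *: s)) (dot (grad f (x + t *: s)) s).
Proof.
have [df _ _] := hf.
apply: is_derive_eq (is_derive_line (df (x + t *: s))) _.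
by apply: eq_bigr => i _; rewrite mxE mulrC.
Qed.

Lemma is_derive_line_hess x s v t :
  is_derive t (1 : R) (fun t => dot (grad f (x + t *: s)) v)
    (dot (hess f (x + t *: s) *m s) v).
Proof.
have [_ dg _] := hf.
pose h (i : 'I_n) : R -> R^o := v i 0 \*: (fun t => grad f (x + t *: s) i 0 : R^o).
have -> : (fun t => dot (grad f (x + t *: s)) v) = \sum_(i < n) h i.
  apply/funext => t'; rewrite fct_sumE; apply: eq_bigr => i _.
  by rewrite /h /= mulrC.
have dh i : is_derive t (1 : R) (h i) (v i 0 * \sum_j s j 0 * hess f (x + t *: s) i j).
  apply: is_deriveZ.
  have dgi : differentiable (fun y => grad f y i 0 : R^o) (x + t *: s).
    by apply: (@differentiable_comp _ _ _ _ (grad f) (fun M => M i 0 : R^o)) => //;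
      exact: differentiable_coord.
  apply: is_derive_eq (is_derive_line dgi) _.
  by apply: eq_bigr => j _; rewrite mxE.
apply: is_derive_eq (is_derive_sum (fun i => dh i)) _.
apply: eq_bigr => i _; rewrite mxE mulrC; congr (_ * _).
by apply: eq_bigr => j _; rewrite mulrC.
Qed.

Lemma hess_lipschitz_dot x y u v :
  dot ((hess f x - hess f y) *m u) v <= LH * enorm (x - y) * enorm u * enorm v.
Proof.
apply: le_trans (cauchy_schwarz _ _) _; rewrite ler_wpM2r ?enorm_ge0//.
by apply: le_trans (opnorm_ub _ _) _; rewrite ler_wpM2r ?enorm_ge0// hLip.
Qed.

(** The mean value bound is scalar, so the gradient is tested against a vector [v] along the
    segment; duality removes [v] afterwards. *)
Lemma grad_taylor_dot x s v :
  dot (grad f (x + s) - grad f x - hess f x *m s) v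
    <= LH / 2 * enorm s ^+ 2 * enorm v.
Proof.
have := quadratic_mean_value (is_derive_line_hess x s v)
  (c0 := dot (hess f x *m s) v) (c1 := LH * enorm s ^+ 2 * enorm v) (c2 := 0).
rewrite !scale1r !scale0r addr0 => h.
have : dot (grad f (x + s)) v - dot (grad f x) v <=
  dot (hess f x *m s) v + LH * enorm s ^+ 2 * enorm v / 2 + 0 / 3.
  apply: h => t t0; rewrite mul0r addr0 -lerBlDl -dotBl -mulmxBl.
  apply: le_trans (hess_lipschitz_dot _ _ _ _) _.
  by rewrite addrC addKr enormZ ger0_norm// le_eqVlt; apply/orP; left; apply/eqP; ring.
rewrite !dotBl; lra.
Qed.

Lemma grad_taylor x s :
  0 <= LH ->
  enorm (grad f (x + s) - grad f x - hess f x *m s) <= LH / 2 * enorm s ^+ 2.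
Proof.
move=> L0; apply: enorm_le_dual => [|v]; first by rewrite mulr_ge0 ?divr_ge0 ?sqr_ge0.
exact: grad_taylor_dot.
Qed.

Lemma taylor_le x s :
  f (x + s) <= f x + dot (grad f x) s + 2^-1 * dot s (hess f x *m s)
    + LH / 6 * enorm s ^+ 3.
Proof.
have := quadratic_mean_value (is_derive_line_grad x s)
  (c0 := dot (grad f x) s) (c1 := dot (hess f x *m s) s) (c2 := LH / 2 * enorm s ^+ 3).
rewrite !scale1r !scale0r addr0 => h.
have : f (x + s) - f x <= dot (grad f x) s + dot (hess f x *m s) s / 2
    + LH / 2 * enorm s ^+ 3 / 3.
  apply: h => t t0; have := grad_taylor_dot x (t *: s) s.
  rewrite !dotBl -scalemxAr dotZl enormZ (ger0_norm t0) => h.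
  rewrite -lerBlDl; apply: le_trans (le_trans _ h) _; first by lra.
  by rewrite le_eqVlt; apply/orP; left; apply/eqP; ring.
rewrite (dotC s); lra.
Qed.

(** The argument for the upper bound, applied to [- f] with the gradient tested against [- s]. It
    serves the symmetry of the Hessian. *)
Lemma taylor_ge x s :
  f x + dot (grad f x) s + 2^-1 * dot s (hess f x *m s) - LH / 6 * enorm s ^+ 3
    <= f (x + s).
Proof.
have dN t : is_derive t (1 : R) (- (fun t => f (x + t *: s) : R))
    (- dot (grad f (x + t *: s)) s).
  by apply: is_deriveN; exact: is_derive_line_grad.
have := quadratic_mean_value dN
  (c0 := - dot (grad f x) s) (c1 := - dot (hess f x *m s) s) (c2 := LH / 2 * enorm s ^+ 3).
rewrite !fctE !scale1r !scale0r addr0 => h.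
have : - f (x + s) - - f x <= - dot (grad f x) s + - dot (hess f x *m s) s / 2
    + LH / 2 * enorm s ^+ 3 / 3.
  apply: h => t t0; have := grad_taylor_dot x (t *: s) (- s).
  rewrite !dotBl -scalemxAr dotZl !dotNr enormZ enormN (ger0_norm t0) => h.
  rewrite -lerBlDl; apply: le_trans (le_trans _ h) _; first by lra.
  by rewrite le_eqVlt; apply/orP; left; apply/eqP; ring.
rewrite (dotC s); lra.
Qed.

Lemma linear_bound_eq0 (a C : R) :
  (forall t, 0 < t -> t <= 1 -> a <= C * t) -> a <= 0.
Proof.
move=> h; rewrite leNgt; apply/negP => a0.
have C0 : 0 < C by have := h 1 ltr01 (lexx _); rewrite mulr1; exact: lt_le_trans.
pose t := Num.min 1 (a / (2 * C)).
have t0 : 0 < t by rewrite lt_min ltr01 divr_gt0// mulr_gt0.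
have := h t t0; rewrite ge_min lexx => /(_ isT).
apply/negP; rewrite -ltNge.
have tle : t <= a / (2 * C) by rewrite ge_min lexx orbT.
have : C * t <= C * (a / (2 * C)) by rewrite ler_pM2l.
have -> : C * (a / (2 * C)) = a / 2 by field; rewrite gt_eqF.
lra.
Qed.

Lemma dot_subZ (A B : 'M[R]_n) (t : R) v :
  dot ((A - B) *m (t *: v)) (t *: v) = t ^+ 2 * (dot (A *m v) v - dot (B *m v) v).
Proof. by rewrite -scalemxAr dotZl dotZr mulmxBl dotBl mulrA -expr2. Qed.

(* Expand [f (x + t u + t v)] at [x] and, in two steps, at [x + t u]: the
   second-order terms agree up to O(t^3). *)
Lemma hess_dot_le x u v : 0 <= LH -> dot (hess f x *m u) v <= dot (hess f x *m v) u.
Proof.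
move=> L0; rewrite -subr_le0.
set H := hess f x.
pose U := enorm u; pose V := enorm v; pose W := enorm (u + v).
have U0 : 0 <= U by exact: enorm_ge0.
have V0 : 0 <= V by exact: enorm_ge0.
pose C := 2 * (LH / 6 * (V ^+ 3 + U ^+ 3 + W ^+ 3) + LH / 2 * U ^+ 2 * V + LH / 2 * U * V ^+ 2).
apply: (@linear_bound_eq0 _ C) => t t0 t1.
have tn : `|t| = t by rewrite gtr0_norm.
have H0 : 0 <= t by exact: ltW.
pose y := x + t *: u.
pose Huv := dot (H *m u) v; pose Hvu := dot (H *m v) u.
pose Huu := dot (H *m u) u; pose Hvv := dot (H *m v) v.
have e1 : f (y + t *: v) <= f x + t * (dot (grad f x) u + dot (grad f x) v)
    + 2^-1 * (t ^+ 2 * (Huu + Huv + Hvu + Hvv)) + LH / 6 * (t * W) ^+ 3.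
  have := taylor_le x (t *: (u + v)).
  rewrite -scalemxAr dotZr dotZl dotZr enormZ tn -/W -/H scalerDr addrA -/y.
  rewrite mulmxDr dotDr dotDl !dotDr (dotC u) (dotC u) !(dotC v) -/Huu -/Huv -/Hvu -/Hvv.
  by move=> /le_trans; apply; rewrite le_eqVlt; apply/orP; left; apply/eqP; ring.
have e2 : f y + t * dot (grad f y) v + 2^-1 * (t ^+ 2 * dot (hess f y *m v) v)
    - LH / 6 * (t * V) ^+ 3 <= f (y + t *: v).
  have := taylor_ge y (t *: v).
  rewrite -scalemxAr dotZr dotZl dotZr enormZ tn -/V (dotC v).
  by move/(le_trans _); apply; rewrite le_eqVlt; apply/orP; left; apply/eqP; ring.
have e3 : - (t * (dot (grad f y) v - dot (grad f x) v - t * Huv))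
    <= LH / 2 * (t * U) ^+ 2 * (t * V).
  have := grad_taylor_dot x (t *: u) (- (t *: v)).
  rewrite -/y -/H dotNr dotZr enormN !enormZ !tn -/U -/V.
  by rewrite !dotBl -scalemxAr dotZl -/Huv.
(* The second step starts at [y]; Lipschitz continuity moves its Hessian back to [x] at a cost of
   order [t ^+ 3]. *)
have e4 : t ^+ 2 * (Hvv - dot (hess f y *m v) v) <= LH * (t * U) * (t * V) * (t * V).
  have xy : x - y = - (t *: u) by rewrite /y opprD addrA subrr add0r.
  have := hess_lipschitz_dot x y (t *: v) (t *: v).
  rewrite xy enormN !enormZ !tn -/U -/V.
  have -> : dot ((hess f x - hess f y) *m (t *: v)) (t *: v)
      = t ^+ 2 * (Hvv - dot (hess f y *m v) v); last by [].
  exact: dot_subZ.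
have e5 : f x + t * dot (grad f x) u + 2^-1 * (t ^+ 2 * Huu) - LH / 6 * (t * U) ^+ 3 <= f y.
  have := taylor_ge x (t *: u).
  rewrite -scalemxAr dotZr dotZl dotZr enormZ tn -/U -/H -/y (dotC u) -/Huu.
  by move/(le_trans _); apply; rewrite le_eqVlt; apply/orP; left; apply/eqP; ring.
have t2 : 0 < t ^+ 2 by rewrite exprn_gt0.
rewrite -(ler_pM2l t2) -(ler_pM2l (_ : 0 < 2^-1))//.
have -> : 2^-1 * (t ^+ 2 * (C * t)) = LH / 6 * ((t * V) ^+ 3 + (t * U) ^+ 3 + (t * W) ^+ 3)
   + LH / 2 * (t * U) ^+ 2 * (t * V) + 2^-1 * (LH * (t * U) * (t * V) * (t * V)).
  by rewrite /C; field.
have -> : 2^-1 * (t ^+ 2 * (Huv - Hvu)) =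
   t * (t * Huv) - 2^-1 * (t ^+ 2 * Huv) - 2^-1 * (t ^+ 2 * Hvu) by field.
move: e1 e2 e3 e4 e5.
rewrite !mulrBr !mulrDr; lra.
Qed.

(** Needed because differentiating the quadratic model produces the symmetric part of the Hessian.
    Exchanging [u] and [v] in [hess_dot_le] gives equality of the bilinear forms. *)
Lemma hess_sym x : 0 <= LH -> (hess f x)^T = hess f x.
Proof.
move=> L0; apply/matrixP => i j; rewrite mxE.
have entry (A : 'M[R]_n) k k' : dot (A *m delta_mx k 0) (delta_mx k' 0) = A k' k.
  rewrite dot_delta mxE (bigD1 k)//= mxE !eqxx mulr1 big1 ?addr0// => m /negbTE mk.
  by rewrite mxE mk mulr0.
by rewrite -!entry; apply/le_anti; rewrite !hess_dot_le.
Qed.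

End Taylor.

(** * The gradient of the cubic model *)

Section ModelGradient.
Context {R : realType}.

(** With [n = |p + t q|] and [a = |p|], one has [n^3 - a^3 - 3/2 a (n^2 - a^2) = (n - a)^2 (n +
    a/2)], and [|n - a| <= |t| |q|]. The error is therefore quadratic in [t] even at [p = 0]. *)
Lemma enorm_cube_bound n (p q : 'cV[R]_n) (t : R) : `|t| <= 1 ->
  `|enorm (p + t *: q) ^+ 3 - enorm p ^+ 3 - t * (3 * enorm p * dot p q)|
    <= enorm q ^+ 2 * (3 * enorm p + enorm q) * t ^+ 2.
Proof.
move=> t1.
have n2 : enorm (p + t *: q) ^+ 2 = enorm p ^+ 2 + 2 * t * dot p q + t ^+ 2 * enorm q ^+ 2.
  by rewrite !enorm_sqr dotDl !dotDr !dotZl !dotZr (dotC q p); ring.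
have tri1 := enormD p (t *: q).
have tri2 := enormD (p + t *: q) (- (t *: q)).
rewrite addrK in tri2.
move: tri1 tri2; rewrite enormN enormZ.
have := enorm_ge0 (p + t *: q); have := enorm_ge0 p; have := enorm_ge0 q.
set nn := enorm (p + t *: q) in n2 *; set a := enorm p in n2 *; set b := enorm q in n2 *.
move=> b0 a0 n0 tri1 tri2.
have -> : nn ^+ 3 - a ^+ 3 - t * (3 * a * dot p q) =
    (nn - a) ^+ 2 * (nn + a / 2) + 3 / 2 * a * (t ^+ 2 * b ^+ 2).
  have -> : t * (3 * a * dot p q) = 3 / 2 * a * (nn ^+ 2 - a ^+ 2 - t ^+ 2 * b ^+ 2).
    by rewrite n2; field.
  by field.
have tb : `|t| * b <= b by rewrite ler_piMl.
have sq : (nn - a) ^+ 2 <= t ^+ 2 * b ^+ 2.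
  rewrite -exprMn -[leLHS]real_normK ?num_real// -[leRHS]real_normK ?num_real//.
  apply: lerXn2r; rewrite ?nnegrE// normrM (ger0_norm b0) ler_norml; apply/andP; split; lra.
have s0 : 0 <= (nn - a) ^+ 2 * (nn + a / 2) by apply: mulr_ge0; [exact: sqr_ge0|lra].
have s1 : 0 <= 3 / 2 * a * (t ^+ 2 * b ^+ 2).
  by apply: mulr_ge0; [lra|apply: mulr_ge0; exact: sqr_ge0].
rewrite ger0_norm; last exact: addr_ge0.
have h : (nn - a) ^+ 2 * (nn + a / 2) <= t ^+ 2 * b ^+ 2 * (a + b + a / 2).
  by apply: ler_pM; [exact: sqr_ge0|lra|exact: sq|lra].
lra.
Qed.

Lemma grad_mhat (l d : nat) (f : 'cV[R]_d -> R) (x : 'cV[R]_d) (alpha : R)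
    (S : 'M[R]_(l, d)) (s : 'cV[R]_l) : 0 < alpha -> (hess f x)^T = hess f x ->
  grad (mhat f x alpha S) s =
    S *m (grad f x + hess f x *m (S^T *m s))
      + (enorm (S^T *m s) / alpha) *: (S *m (S^T *m s)).
Proof.
move=> a0 symH; apply/matrixP => i j; rewrite (ord1 j) {j} [LHS]mxE.
rewrite -(dot_delta (_ + _) i); set v := delta_mx i 0.
set g := grad f x; set H := hess f x; set p := S^T *m s; set q := S^T *m v.
apply: (@derive_of_quadratic_bound _ _ _ _ _ _
  (2^-1 * `|dot q (H *m q)| + (3 * alpha)^-1 * (enorm q ^+ 2 * (3 * enorm p + enorm q)))).
move=> t t1.
have quadE (u : 'cV[R]_l) : dot u (S *m H *m S^T *m u) = dot (S^T *m u) (H *m (S^T *m u)).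
  by rewrite [RHS]dot_mulmx trmxK !mulmxA.
have linE (u : 'cV[R]_l) : dot (S *m g) u = dot g (S^T *m u) by rewrite dot_mulmx.
(* The quadratic term contributes both cross terms; symmetry merges them into one and cancels the
   factor 1/2. *)
have symE : dot q (H *m p) = dot p (H *m q) by rewrite dotC dot_mulmx symH.
have := enorm_cube_bound p q t1.
set cube := _ - _ - _ => hc.
have -> : mhat f x alpha S (s + t *: v) - mhat f x alpha S s
    - t * dot (S *m (g + H *m p) + (enorm p / alpha) *: (S *m p)) v =
    2^-1 * (t ^+ 2 * dot q (H *m q)) + (3 * alpha)^-1 * cube.
  have -> : dot (S *m (g + H *m p) + (enorm p / alpha) *: (S *m p)) v =
      dot g q + dot p (H *m q) + enorm p / alpha * dot p q.
    by rewrite dotDl dotZl (dot_mulmx S (g + _)) (dot_mulmx S p) dotDl -symE (dotC q).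
  rewrite /mhat /qhat -/g -/H !quadE !linE mulmxDr -scalemxAr -/p -/q.
  rewrite (mulmxDr H) -scalemxAr !dotDr !dotDl !dotZl !dotZr symE /cube.
  by field; rewrite gt_eqF.
apply: le_trans (ler_normD _ _) _.
rewrite (normrM 2^-1) (normrM (t ^+ 2)) (normrM _^-1) (ger0_norm (x := 2^-1))// (ger0_norm (sqr_ge0 t)).
rewrite [`|(3 * alpha)^-1|]ger0_norm ?invr_ge0 ?mulr_ge0 ?(ltW a0)//.
rewrite [leRHS]mulrDl; apply: lerD; first by rewrite le_eqVlt; apply/orP; left; apply/eqP; ring.
by rewrite -mulrA ler_wpM2l// invr_ge0 mulr_ge0 ?(ltW a0).
Qed.

End ModelGradient.

(* Layer cake: [phi (X w)] is the length of [`[0, phi (X w)[], so by Tonelli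
   an identity between integrals of indicators extends to [phi]. *)
Section LayerCake.
Context {R : realType}.

(** The condition [0 <= t] removes the negative levels, which would add infinite length. *)
Let level (phi : R -> R) (t : R) : set R := [set x | (0 <= t) && (t < phi x)].

Let measurable_level (phi : R -> R) (t : R) :
  measurable_fun setT phi -> measurable (level phi t).
Proof.
move=> mphi; rewrite /level; have [t0|t0] /= := boolP (0 <= t).
  have -> : [set x | t < phi x] = phi @^-1` `]t, +oo[%classic.
    by apply/seteqP; split => x /=; rewrite in_itv/= andbT.
  rewrite -[X in measurable X]setTI; exact: mphi.
by rewrite (_ : [set x | false] = set0)//; apply/seteqP; split.
Qed.

Let level_length (phi : R -> R) (x : R) : 0 <= phi x ->
  ((phi x)%:E = \int[@lebesgue_measure R]_t (\1_(level phi t) x)%:E)%E.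
Proof.
move=> phi0.
transitivity (\int[@lebesgue_measure R]_t (\1_(`[0, phi x[%classic) t)%:E)%E.
  rewrite integral_indic//= setIT.
  rewrite (@lebesgue_measure_itv R `[0, phi x[) /= lte_fin.
  move: phi0; rewrite le_eqVlt => /orP[/eqP <-|->]; first by rewrite ltxx.
  by rewrite oppr0 adde0.
apply: eq_integral => t _; rewrite !indicE.
have e : (t \in `[0, phi x[%classic) = (x \in level phi t).
  by apply/idP/idP => /set_mem h; apply/mem_set; move: h; rewrite /= ?in_itv.
by rewrite e.
Qed.

Let measurable_level_indic d (T : measurableType d) (X : T -> R) (phi : R -> R) :
  measurable_fun setT X -> measurable_fun setT phi ->
  measurable_fun setT (fun z : T * R => \1_(level phi z.2) (X z.1) : R).
Proof.
move=> mX mphi.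
have -> : (fun z : T * R => \1_(level phi z.2) (X z.1) : R) =
    (fun z => if (0 <= z.2) && (z.2 < phi (X z.1)) then 1 else 0).
  apply/funext => z; rewrite indicE; case: ifPn => h; first by rewrite mem_set.
  by rewrite memNset//; exact/negP.
apply: measurable_fun_ifT => //.
apply: measurable_and; first exact: measurable_fun_ler.
apply: measurable_fun_ltr => //.
by do 2!apply: measurableT_comp => //.
Qed.

Let layer_cake d (T : measurableType d) (m : {sigma_finite_measure set T -> \bar R})
    (W X : T -> R) (phi : R -> R) :
  measurable_fun setT W -> measurable_fun setT X -> measurable_fun setT phi ->
  (forall w, 0 <= W w) -> (forall x, 0 <= phi x) ->
  (\int[m]_w (W w * phi (X w))%:E =
   \int[@lebesgue_measure R]_t \int[m]_w (W w * \1_(level phi t) (X w))%:E)%E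
  /\ measurable_fun setT
       (fun t => \int[m]_w (W w * \1_(level phi t) (X w))%:E)%E.
Proof.
move=> mW mX mphi W0 phi0; have mIn := measurable_level_indic mX mphi.
have mF : measurable_fun setT
    (fun z : T * R => (W z.1 * \1_(level phi z.2) (X z.1))%:E).
  apply/measurable_EFinP; apply: measurable_funM => //.
  exact: measurableT_comp.
have F0 (z : T * R) : (0 <= (W z.1 * \1_(level phi z.2) (X z.1))%:E)%E.
  by rewrite lee_fin mulr_ge0.
split; last exact: (@measurable_fun_fubini_tonelli_G _ _ _ _ R m _ mF F0).
rewrite -(@fubini_tonelli _ _ _ _ _ m (@lebesgue_measure R) _ mF F0) /=.
apply: eq_integral => w _; rewrite EFinM level_length// -ge0_integralZl_EFin//.
apply/measurable_EFinP.
exact: (measurableT_comp mIn (pair1_measurable w)).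
Qed.

(** Allowing weights and two different measure spaces makes one statement serve twice: to split off
    one independent factor (the weight is the product of the others) and to pass from a law to its
    density (the weight is the density). *)
Lemma integral_mul_comp
    d1 (T1 : measurableType d1) (m1 : {sigma_finite_measure set T1 -> \bar R})
    d2 (T2 : measurableType d2) (m2 : {sigma_finite_measure set T2 -> \bar R})
    (W1 X1 : T1 -> R) (W2 X2 : T2 -> R) (phi : R -> R) (c : \bar R) :
  measurable_fun setT W1 -> measurable_fun setT X1 -> (forall w, 0 <= W1 w) ->
  measurable_fun setT W2 -> measurable_fun setT X2 -> (forall w, 0 <= W2 w) ->
  measurable_fun setT phi -> (forall x, 0 <= phi x) -> (0 <= c)%E ->
  (forall B : set R, measurable B ->
    \int[m1]_w (W1 w * \1_B (X1 w))%:E = c * \int[m2]_w (W2 w * \1_B (X2 w))%:E)%E ->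
  (\int[m1]_w (W1 w * phi (X1 w))%:E = c * \int[m2]_w (W2 w * phi (X2 w))%:E)%E.
Proof.
move=> mW1 mX1 W10 mW2 mX2 W20 mphi phi0 c0 H.
rewrite (layer_cake _ mW1 mX1 mphi W10 phi0).1.
have [-> m2L] := layer_cake m2 mW2 mX2 mphi W20 phi0.
rewrite -ge0_integralZl//.
  by apply: eq_integral => t _; rewrite H//; exact: measurable_level.
by move=> t _; apply: integral_ge0 => w _; rewrite lee_fin mulr_ge0.
Qed.

End LayerCake.

(** * Integrals of products of independent variables *)

Section IndependentProducts.
Context {R : realType} {disp : measure_display} {T : measurableType disp}.
Variable P : probability T R.

(** Induction on the list of indices whose function is not yet an indicator. With the empty list the
    claim is the product rule for events; each step reduces one function to indicators through
    [integral_mul_comp]. *)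
Lemma integral_prod_indep (I : finType) (X : I -> T -> R) (phi : I -> R -> R) :
  (forall i, measurable_fun setT (X i)) ->
  (forall (J : {set I}) (B : I -> set R), (forall i, measurable (B i)) ->
     P [set w | forall i, i \in J -> B i (X i w)]
       = (\prod_(i in J) P [set w | B i (X i w)])%E) ->
  (forall i, measurable_fun setT (phi i)) -> (forall i x, 0 <= phi i x) ->
  (\int[P]_w (\prod_i phi i (X i w))%:E
     = \prod_i \int[P]_w (phi i (X i w))%:E)%E.
Proof.
move=> mX indep.
have mXB i (B : set R) : measurable B -> measurable [set w | B (X i w)].
  by move=> mB; rewrite -[X in measurable X]setTI; exact: mX.
suff main (s : seq I) (psi : I -> R -> R) :
    (forall i, measurable_fun setT (psi i)) -> (forall i x, 0 <= psi i x) ->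
    (forall i, i \notin s -> exists2 B : set R, measurable B & psi i = \1_B) ->
    (\int[P]_w (\prod_i psi i (X i w))%:E
       = \prod_i \int[P]_w (psi i (X i w))%:E)%E.
  by move=> mphi phi0; apply: (main (enum I)) => // i; rewrite mem_enum.
elim: s psi => [|j s IH] psi mpsi psi0 ind.
  have {}ind i : {B : set R | measurable B & psi i = \1_B}.
    by apply: cid2; exact: ind.
  pose B i := s2val (ind i).
  have mB i : measurable (B i) by exact: (s2valP (ind i)).
  pose U : {set I} := finset predT.
  have psiE i : psi i = \1_(B i) by exact: (s2valP' (ind i)).
  transitivity (P [set w | forall i, i \in U -> B i (X i w)]).
    rewrite -[RHS](_ : (\int[P]_w (\1_([set w | forall i, i \in U -> B i (X i w)]) w)%:E)%E = _).
      apply: eq_integral => w _; congr EFin; rewrite indicE.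
      have [/set_mem /= h|h] := boolP (w \in _).
        by rewrite big1// => i _; rewrite psiE indicE mem_set//; apply: h; rewrite finset.in_set.
      have [i hi] : exists i, ~ B i (X i w).
        apply/existsNP => h'; move/negP: h; apply; apply/mem_set => i _; exact: h'.
      by rewrite (bigD1 i)//= psiE indicE memNset// mul0r.
    rewrite integral_indic ?setIT//.
    have -> : [set w | forall i, i \in U -> B i (X i w)]
       = \bigcap_(i in setT) [set w | B i (X i w)].
      by apply/seteqP; split => w /= h i; [move=> _; apply: h; rewrite finset.in_set|move=> _; exact: h].
    by apply: fin_bigcap_measurable => // i _; exact: mXB.
  rewrite indep//; apply: eq_big => [i|i _]; first by rewrite finset.in_set.
  under eq_integral do rewrite psiE.
  rewrite -[in LHS](setIT [set w | _]) -integral_indic//; last exact: mXB.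
pose chi (B : set R) i := if i == j then \1_B else psi i.
have split (p : I -> R -> R) w : \prod_i p i (X i w) =
    (\prod_(i | i != j) p i (X i w)) * p j (X j w).
  by rewrite (bigD1 j)//= mulrC.
have mW : measurable_fun setT (fun w => \prod_(i | i != j) psi i (X i w)).
  have -> : (fun w => \prod_(i | i != j) psi i (X i w)) =
      (fun w => \prod_i (if i != j then psi i (X i w) else 1)).
    by apply/funext => w; exact: big_mkcond.
  apply: measurable_prod => i _; case: (i != j) => //.
  exact: measurableT_comp.
under eq_integral do rewrite split.
rewrite [RHS](bigD1 j)//= muleC.
transitivity ((\prod_(i | i != j) \int[P]_w (psi i (X i w))%:E) *
    \int[P]_w (cst 1 w * psi j (X j w))%:E)%E; last first.
  by under eq_integral do rewrite /= mul1r.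
apply: integral_mul_comp => //.
- by move=> w; exact: prodr_ge0.
- by apply: prode_ge0 => i _; apply: integral_ge0 => w _; rewrite lee_fin.
move=> B mB.
under [in RHS]eq_integral do rewrite /= mul1r.
have chij : chi B j = \1_B by rewrite /chi eqxx.
have chiN i : i != j -> chi B i = psi i by move=> /negbTE ij; rewrite /chi ij.
transitivity (\int[P]_w (\prod_i chi B i (X i w))%:E)%E.
  apply: eq_integral => w _; rewrite split chij; congr (_ * _)%:E.
  by apply: eq_bigr => i ij; rewrite chiN.
rewrite IH.
- rewrite (bigD1 j)//= muleC chij; congr (_ * _)%E.
  by apply: eq_bigr => i ij; rewrite chiN.
- by move=> i; rewrite /chi; case: (i == j) => //; exact: measurable_indic.
- by move=> i x; rewrite /chi; case: (i == j).
- move=> i si; have [->|ij] := eqVneq i j; first by exists B.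
  by rewrite chiN//; apply: ind; rewrite inE negb_or ij.
Qed.

End IndependentProducts.

(** * Gaussian moment generating functions *)

Section GaussianIntegrals.
Context {R : realType}.
Notation mu := lebesgue_measure.

(** Exponential tilting: completing the square turns the integrand into a multiple of the normal
    density of mean [s ^+ 2 * a]. *)
Lemma gauss_mgf (s a : R) : s != 0 ->
  (\int[mu]_x (normal_pdf 0 s x * expR (a * x))%:E
    = (expR (a ^+ 2 * s ^+ 2 / 2))%:E)%E.
Proof.
move=> s0.
transitivity (\int[mu]_x ((expR (a ^+ 2 * s ^+ 2 / 2))%:E *
    (normal_pdf (s ^+ 2 * a) s x)%:E))%E.
  apply: eq_integral => x _; rewrite -EFinM !normal_pdfE//= /normal_fun.
  congr EFin; rewrite -[LHS]mulrA -expRD [RHS]mulrCA -expRD; congr (_ * expR _).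
  by field.
rewrite ge0_integralZl_EFin ?expR_ge0//; last 2 first.
- by move=> x _; rewrite lee_fin normal_pdf_ge0.
- by apply/measurable_EFinP; exact: measurable_normal_pdf.
by rewrite /= integral_normal_pdf mule1.
Qed.

(* Completing the square turns [normal_pdf 0 1 x * expR (t x^2)] into the
   density of variance [1 / (1 - 2 t)], up to the factor [s]. *)
Lemma gauss_square_mgf (t s : R) : 0 < s -> 1 - 2 * t = (s ^+ 2)^-1 ->
  (\int[mu]_x (normal_pdf 0 1 x * expR (t * x ^+ 2))%:E = s%:E)%E.
Proof.
move=> s0 ts.
transitivity (\int[mu]_x (s%:E * (normal_pdf 0 s x)%:E))%E.
  apply: eq_integral => x _; rewrite -EFinM !normal_pdfE ?gt_eqF//=.
  rewrite /normal_fun; congr EFin; rewrite -[LHS]mulrA -expRD [RHS]mulrA; congr (_ * expR _).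
    rewrite /normal_peak expr1n mul1r -[s ^+ 2 * _ *+ 2]mulrnAr.
    rewrite sqrtrM ?sqr_ge0// sqrtr_sqr gtr0_norm// invfM mulrA divff ?gt_eqF//.
    by rewrite mul1r.
  have -> : t = (1 - (s ^+ 2)^-1) / 2 by lra.
  by field; rewrite gt_eqF.
rewrite ge0_integralZl_EFin//; last 3 first.
- by move=> x _; rewrite lee_fin normal_pdf_ge0.
- by apply/measurable_EFinP; exact: measurable_normal_pdf.
- exact: ltW.
by rewrite /= integral_normal_pdf mule1.
Qed.

End GaussianIntegrals.

Section GaussianVectors.
Context {R : realType} {disp : measure_display} {T : measurableType disp}.
Variable P : probability T R.

(* [expR (eta x^2)] is a Gaussian mixture of the functions [expR (a x)], so the
   coordinates can be replaced one by one. *)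
Lemma gauss_square_mgf_indep (I : finType) (X : I -> T -> R) (v eta s : R) :
  (forall i, measurable_fun setT (X i)) ->
  (forall a : I -> R,
    \int[P]_w (\prod_i expR (a i * X i w))%:E
      = (\prod_i expR (a i ^+ 2 * v / 2))%:E)%E ->
  0 <= eta -> 0 < s -> 1 - 2 * (eta * v) = (s ^+ 2)^-1 ->
  (\int[P]_w (\prod_i expR (eta * X i w ^+ 2))%:E = (s ^+ #|I|)%:E)%E.
Proof.
move=> mX mgf eta0 s0 etas.
(* Coordinates in [r] already carry the squared exponent. The coefficients [a] stay arbitrary
   because the mixture replaces the one at [j] by [sqrt (2 * eta) * g] with [g] Gaussian. *)
pose psi (r : seq I) (a : I -> R) i w :=
  if i \in r then expR (eta * X i w ^+ 2) else expR (a i * X i w).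
pose K (r : seq I) (a : I -> R) i := if i \in r then s else expR (a i ^+ 2 * v / 2).
suff main r : uniq r -> forall a,
    (\int[P]_w (\prod_i psi r a i w)%:E = (\prod_i K r a i)%:E)%E.
  transitivity (\int[P]_w (\prod_i psi (enum I) (fun=> 0) i w)%:E)%E.
    apply: eq_integral => w _; congr EFin; apply: eq_bigr => i _.
    by rewrite /psi mem_enum.
  rewrite main ?enum_uniq//; congr EFin; rewrite -prodr_const.
  by apply: eq_bigr => i _; rewrite /K mem_enum.
elim: r => [|j r IH] /=; first by move=> _ a; exact: mgf.
move=> /andP[jr ur] a.
have mpsi r' b i : measurable_fun setT (psi r' b i).
  rewrite /psi; case: (i \in r').
    apply: measurableT_comp => //; apply: measurable_funM => //.
    exact: measurable_funX.
  by apply: measurableT_comp => //; exact: measurable_funM.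
have psi0 r' b i w : 0 <= psi r' b i w.
  by rewrite /psi; case: (i \in r'); exact: expR_ge0.
pose Q w := \prod_(i | i != j) psi r a i w.
have mQ : measurable_fun setT Q.
  have -> : Q = fun w => \prod_i (if i != j then psi r a i w else 1).
    by apply/funext => w; exact: big_mkcond.
  by apply: measurable_prod => i _; case: (i != j) => //; exact: mpsi.
have Q0 w : 0 <= Q w by exact: prodr_ge0.
pose upd (g : R) i := if i == j then Num.sqrt (2 * eta) * g else a i.
have updE g w : \prod_i psi r (upd g) i w = Q w * expR (Num.sqrt (2 * eta) * X j w * g).
  rewrite (bigD1 j)//= mulrC; congr (_ * _).
    by apply: eq_bigr => i /negbTE ij; rewrite /psi /upd ij.
  by rewrite /psi (negbTE jr) /upd eqxx mulrAC.
have sq2 : Num.sqrt (2 * eta) ^+ 2 = 2 * eta by rewrite sqr_sqrtr// mulr_ge0.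
transitivity (\int[P]_w \int[@lebesgue_measure R]_g
   (Q w * (normal_pdf 0 1 g * expR (Num.sqrt (2 * eta) * X j w * g)))%:E)%E.
  apply: eq_integral => w _; rewrite (bigD1 j)//= mulrC.
  have -> : \prod_(i | i != j) psi (j :: r) a i w = Q w.
    by apply: eq_bigr => i /negbTE ij; rewrite /psi inE ij.
  under [RHS]eq_integral do rewrite EFinM.
  rewrite ge0_integralZl_EFin//; last 2 first.
  - by move=> g _; rewrite lee_fin mulr_ge0 ?normal_pdf_ge0 ?expR_ge0.
  - apply/measurable_EFinP; apply: measurable_funM; first exact: measurable_normal_pdf.
    by apply: measurableT_comp => //; exact: measurable_funM.
  rewrite gauss_mgf ?oner_neq0// -EFinM /psi inE eqxx /= exprMn sq2; congr (_ * expR _)%:E.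
  by field.
pose F (z : T * R) : \bar R :=
  (Q z.1 * (normal_pdf 0 1 z.2 * expR (Num.sqrt (2 * eta) * X j z.1 * z.2)))%:E.
have mX1 i : measurable_fun setT (fun z : T * R => X i z.1) by exact: measurableT_comp.
have mF : measurable_fun setT F.
  apply/measurable_EFinP; apply: measurable_funM; first exact: measurableT_comp.
  apply: measurable_funM; first by apply: measurableT_comp => //; exact: measurable_normal_pdf.
  apply: measurableT_comp => //; apply: measurable_funM => //.
  exact: measurable_funM.
have F0 z : (0 <= F z)%E.
  by rewrite lee_fin !mulr_ge0 ?normal_pdf_ge0 ?expR_ge0.
rewrite (@fubini_tonelli _ _ _ _ _ P (@lebesgue_measure R) F mF F0)/=.
pose C := \prod_(i | i != j) K r a i.
transitivity (\int[@lebesgue_measure R]_g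
   (C%:E * (normal_pdf 0 1 g * expR (eta * v * g ^+ 2))%:E))%E.
  apply: eq_integral => g _.
  transitivity ((normal_pdf 0 1 g)%:E * \int[P]_w (\prod_i psi r (upd g) i w)%:E)%E.
    rewrite -ge0_integralZl_EFin//; last 3 first.
    - by move=> w _; rewrite lee_fin prodr_ge0.
    - by apply/measurable_EFinP; apply: measurable_prod => i _; exact: mpsi.
    - exact: normal_pdf_ge0.
    by apply: eq_integral => w _; rewrite -EFinM updE mulrCA.
  rewrite IH// -!EFinM mulrCA; congr (_ * _)%:E.
  rewrite (bigD1 j)//= mulrC; congr (_ * _).
    by apply: eq_bigr => i /negbTE ij; rewrite /K /upd ij.
  rewrite /K (negbTE jr) /upd eqxx exprMn sq2; congr expR.
  by field.
rewrite ge0_integralZl_EFin//; last 3 first.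
- by move=> g _; rewrite lee_fin mulr_ge0 ?normal_pdf_ge0 ?expR_ge0.
- apply/measurable_EFinP; apply: measurable_funM; first exact: measurable_normal_pdf.
  by apply: measurableT_comp => //; apply: measurable_funM => //; exact: measurable_funX.
- apply: prodr_ge0 => i _; rewrite /K; case: (i \in r); [exact: ltW|exact: expR_ge0].
rewrite (gauss_square_mgf s0)// -EFinM [in RHS](bigD1 j)//= mulrC; congr (_ * _)%:E.
  by rewrite /K inE eqxx.
by apply: eq_bigr => i /negbTE ij; rewrite /K inE ij.
Qed.

End GaussianVectors.

Section ScaledGaussian.
Context {R : realType} {disp : measure_display} {T : measurableType disp}.
Variable P : probability T R.

Lemma integral_normal_law (X : T -> R) (s : R) (phi : R -> R) :
  measurable_fun setT X ->
  (forall B : set R, measurable B -> pushforward P X B = normal_prob 0 s B) ->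
  measurable_fun setT phi -> (forall x, 0 <= phi x) ->
  (\int[P]_w (phi (X w))%:E
     = \int[lebesgue_measure]_x (normal_pdf 0 s x * phi x)%:E)%E.
Proof.
move=> mX law mphi phi0.
transitivity (\int[P]_w (cst 1 w * phi (X w))%:E)%E.
  by under [RHS]eq_integral do rewrite /= mul1r.
rewrite -[RHS]mul1e.
apply: (@integral_mul_comp R _ T P _ _ (@lebesgue_measure R) (cst 1) X
          (normal_pdf 0 s) idfun) => //.
- exact: measurable_normal_pdf.
- exact: measurable_id.
- by move=> x; exact: normal_pdf_ge0.
move=> B mB; rewrite mul1e.
under eq_integral do rewrite /= mul1r.
transitivity (P (X @^-1` B)).
  rewrite -[in RHS](setIT (X @^-1` B)) -integral_indic//.
  by rewrite -[X in measurable X]setTI; exact: mX.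
have := law B mB; rewrite /pushforward => ->.
rewrite /normal_prob integral_mkcond; apply: eq_integral => x _.
rewrite patchE indicE; case: ifP => _; by rewrite ?mulr1 ?mulr0.
Qed.

Variables (l d : nat) (S : T -> 'M[R]_(l, d)).
Hypothesis l0 : (0 < l)%N.
Hypothesis gS : scaled_gaussian P S.

Let lR0 : 0 < l%:R :> R. Proof. by rewrite ltr0n. Qed.

(** The joint generating function of independent normal variables of variance [dot y y / l]. Knowing
    it suffices for the squared exponent, so the law of a sum of Gaussians need not be
    identified. *)
Lemma scaled_gaussian_row_mgf (y : 'cV[R]_d) (a : 'I_l -> R) :
  (\int[P]_w (\prod_i expR (a i * (S w *m y) i 0))%:E
     = (\prod_i expR (a i ^+ 2 * (dot y y / l%:R) / 2))%:E)%E.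
Proof.
have [mS lawS indS] := gS.
have pairE (F : 'I_l -> 'I_d -> R) :
    \prod_i expR (\sum_j F i j) = \prod_(ij : 'I_l * 'I_d) expR (F ij.1 ij.2).
  rewrite (eq_bigr _ (fun i _ => expR_sum _ _ _)).
  exact: (pair_bigA _ (fun i j => expR (F i j))).
transitivity (\int[P]_w (\prod_(ij : 'I_l * 'I_d)
    expR (a ij.1 * y ij.2 0 * S w ij.1 ij.2))%:E)%E.
  apply: eq_integral => w _; congr EFin.
  rewrite -(pairE (fun i j => a i * y j 0 * S w i j)).
  apply: eq_bigr => i _; rewrite mxE mulr_sumr; congr expR.
  by apply: eq_bigr => j _; ring.
rewrite (@integral_prod_indep R _ T P _ (fun ij w => S w ij.1 ij.2)
   (fun ij x => expR (a ij.1 * y ij.2 0 * x))) //; last first.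
  move=> ij; apply: measurableT_comp => //; exact: measurable_funM.
transitivity (\prod_(ij : 'I_l * 'I_d)
   (expR (a ij.1 ^+ 2 * (y ij.2 0 * y ij.2 0 / l%:R) / 2))%:E)%E.
  apply: eq_bigr => -[i j] _ /=.
  rewrite (integral_normal_law (X := fun w => S w i j)
     (phi := fun x => expR (a i * y j 0 * x)) (mS i j) (lawS i j)); last 2 first.
  - by apply: measurableT_comp => //; exact: measurable_funM.
  - by move=> x; exact: expR_ge0.
  rewrite gauss_mgf ?gt_eqF ?sqrtr_gt0 ?invr_gt0//.
  rewrite sqr_sqrtr ?invr_ge0 ?ler0n//; congr (expR _)%:E; ring.
rewrite prodEFin; congr EFin.
rewrite -(pairE (fun i j => a i ^+ 2 * (y j 0 * y j 0 / l%:R) / 2)).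
apply: eq_bigr => i _; congr expR.
by rewrite /dot !mulr_suml mulr_sumr mulr_suml.
Qed.

(** Adding [b] in the denominator keeps the exponent subcritical for every [y]: with [Y = dot y y]
    the expectation of the first exponential is [(1 + Y / b)^(l/2)], at most [exp (l Y / (2 b))].
    One [b] then serves all grid points. *)
Lemma scaled_gaussian_norm_mgf (y : 'cV[R]_d) (b : R) : 0 < b ->
  (\int[P]_w (expR (l%:R / 2 * dot (S w *m y) (S w *m y) / (b + dot y y)
     - l%:R * dot y y / (2 * b)))%:E <= 1)%E.
Proof.
move=> b0; have [mS _ _] := gS.
have y0 := dot_ge0 y.
have by0 : 0 < b + dot y y by rewrite ltr_wpDr.
have mSy i : measurable_fun setT (fun w => (S w *m y) i 0).
  under eq_fun do rewrite mxE.
  by apply: measurable_sum => j; exact: measurable_funM.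
pose s := Num.sqrt (1 + dot y y / b).
have s2 : s ^+ 2 = 1 + dot y y / b.
  by rewrite sqr_sqrtr// addr_ge0// divr_ge0// ltW.
have s0 : 0 < s by rewrite sqrtr_gt0 ltr_pwDl// divr_ge0// ltW.
have := @gauss_square_mgf_indep R _ T P _ (fun i w => (S w *m y) i 0) (dot y y / l%:R)
  (l%:R / 2 / (b + dot y y)) s mSy (scaled_gaussian_row_mgf y).
rewrite card_ord => h.
pose c := expR (- (l%:R * dot y y / (2 * b))).
have -> : (\int[P]_w (expR (l%:R / 2 * dot (S w *m y) (S w *m y) / (b + dot y y)
     - l%:R * dot y y / (2 * b)))%:E = c%:E * (s ^+ l)%:E)%E.
  rewrite -h//; last 2 first.
  - by rewrite !divr_ge0// ltW.
  - rewrite s2; field; rewrite !gt_eqF// (_ : b + _ = b + dot y y)//.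
  rewrite -ge0_integralZl_EFin ?expR_ge0//; last 2 first.
  - by move=> w _; rewrite lee_fin prodr_ge0// => i _; exact: expR_ge0.
  - apply/measurable_EFinP; apply: measurable_prod => i _.
    apply: measurableT_comp => //; apply: measurable_funM => //.
    exact: measurable_funX.
  apply: eq_integral => w _; rewrite -EFinM; congr EFin; rewrite expRD [RHS]mulrC; congr (_ * _).
  by rewrite -expR_sum -mulr_sumr; congr expR; rewrite [LHS]mulrAC; congr (_ * _).
rewrite -EFinM lee_fin.
have : s ^+ l <= expR (dot y y / (2 * b)) ^+ l.
  apply: lerXn2r; [by rewrite nnegrE ltW|by rewrite nnegrE expR_ge0|].
  rewrite -(@ler_pXn2r _ 2) ?nnegrE ?expR_ge0 ?(ltW s0)// s2 -expRM_natl.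
  apply: le_trans (expR_ge1Dx _) _; rewrite ler_expR le_eqVlt; apply/orP; left.
  by apply/eqP; field; rewrite gt_eqF.
rewrite -expRM_natl => h'.
apply: (le_trans (ler_wpM2l (expR_ge0 _) h')).
rewrite -expRD -[leRHS]expR0 ler_expR le_eqVlt; apply/orP; left.
by apply/eqP; field; rewrite gt_eqF.
Qed.

End ScaledGaussian.

(** * The weighted grid: numerical bounds, total weight and rounding *)

Section Grid.
Context {R : realType}.

(** [e >= (1 + 1/16)^16], computed by four squarings with rounding down. *)
Lemma expR1_lb : 263 / 100 <= expR 1 :> R.
Proof.
have -> : 1 = 16%:R * 16^-1 :> R by field.
rewrite expRM_natl.
have h : 17 / 16 <= expR 16^-1 :> R.
  by apply: le_trans (expR_ge1Dx _); lra.
have sq (a c : R) n : 0 <= a -> a <= expR 16^-1 ^+ n -> c <= a ^+ 2 ->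
    c <= expR 16^-1 ^+ (n * 2).
  move=> a0 ha /le_trans; apply; rewrite exprM; apply: lerXn2r => //.
    exact: le_trans ha.
have h1 : 289 / 256 <= expR 16^-1 ^+ 2 :> R by apply: (sq _ _ 1%N _ h); lra.
have {}h1 : 637 / 500 <= expR 16^-1 ^+ 4 :> R by apply: (sq _ _ 2%N _ h1); lra.
have {}h1 : 1623 / 1000 <= expR 16^-1 ^+ 8 :> R by apply: (sq _ _ 4%N _ h1); lra.
by apply: (sq _ _ 8%N _ h1); lra.
Qed.

(** The left side is the price of the union bound per unit of [d / l]: [43/20] normalises the
    weights of one coordinate, and [3/2] is the squared norm 1 plus the rounding error 1/2.
    Multiplied by 6, the claim becomes [(43/20)^12 * 2^9 <= e^16]. *)
Lemma grid_entropy_bound : 2 * ln (43 / 20) + 3 / 2 * ln 2 <= 8 / 3 :> R.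
Proof.
suff : ln ((43 / 20) ^+ 12 * 2 ^+ 9) <= 16 :> R.
  rewrite lnM ?posrE ?exprn_gt0//.
  rewrite !lnXn//.
  lra.
rewrite -[leRHS]expRK ler_ln ?posrE ?expR_gt0 ?mulr_gt0 ?exprn_gt0//.
rewrite -[X in expR X]mulr1 -[X in expR (X * _)]/(16%:R).
rewrite expRM_natl.
have sq (a c x : R) : 0 <= a -> a <= x -> c <= a ^+ 2 -> c <= x ^+ 2.
  by move=> a0 ax /le_trans; apply; apply: lerXn2r => //; exact: le_trans ax.
have h2 : 69 / 10 <= expR 1 ^+ 2 :> R by apply: (sq _ _ _ _ expR1_lb); lra.
have h4 : 476 / 10 <= expR 1 ^+ 4 :> R by rewrite (exprM _ 2 2); apply: (sq _ _ _ _ h2); lra.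
have h8 : 226 * 10 <= expR 1 ^+ 8 :> R by rewrite (exprM _ 4 2); apply: (sq _ _ _ _ h4); lra.
rewrite (exprM _ 8 2); apply: (sq _ _ _ _ h8); first lra.
have h : (43 / 20) ^+ 4 <= 214 / 10 :> R by rewrite !exprS expr0; lra.
have {}h : (43 / 20) ^+ 4 * 2 ^+ 3 <= 1712 / 10 :> R by rewrite !exprS expr0; lra.
have -> : (43 / 20) ^+ 12 * 2 ^+ 9 = ((43 / 20) ^+ 4 * 2 ^+ 3) ^+ 3 :> R.
  by rewrite [RHS]exprMn -!exprM.
apply: (@le_trans _ _ ((1712 / 10) ^+ 3)).
  by apply: lerXn2r => //; rewrite nnegrE; lra.
rewrite !exprS expr0; lra.
Qed.

(** One of the two truncated differences vanishes, so this is [|k - K|]; the index [k] stands for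
    the integer [k - K]. *)
Definition grid_dist (K k : nat) : nat := (k - K) + (K - k).

(** The slack [2^-(K+6)] makes the induction work: the two new end terms are each at most a quarter
    of it, and the slack is halved. *)
Lemma grid_sum_le (K : nat) :
  \sum_(k < K.+2.*2.+1) (2^-1 ^+ (grid_dist K.+2 k ^ 2))
    <= 43 / 20 - 2^-1 ^+ (K + 6) :> R.
Proof.
elim: K => [|K IH].
  by rewrite !big_ord_recl big_ord0 /grid_dist /= !exprS expr0; lra.
rewrite doubleS big_ord_recl big_ord_recr /=.
have -> : \sum_(i < K.+2.*2.+1) 2^-1 ^+ (grid_dist K.+3 (bump 0 i) ^ 2) =
    \sum_(i < K.+2.*2.+1) 2^-1 ^+ (grid_dist K.+2 i ^ 2) :> R.
  by apply: eq_bigr => i _; congr (2^-1 ^+ (_ ^ 2)).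
have -> : grid_dist K.+3 0 = K.+3 by rewrite /grid_dist; lia.
have -> : grid_dist K.+3 (bump 0 K.+2.*2.+1) = K.+3.
  by rewrite (_ : bump 0 K.+2.*2.+1 = K.+2.*2.+2)// /grid_dist; lia.
have -> : (K.+3 ^ 2 = (K + 6) + 2 + (K ^ 2 + 5 * K + 1))%N by nia.
set e : R := 2^-1 ^+ (K + 6).
have e0 : 0 <= e by rewrite exprn_ge0// invr_ge0.
have h : 2^-1 ^+ (K + 6 + 2 + (K ^ 2 + 5 * K + 1)) <= 2^-1 ^+ (K + 6 + 2) :> R.
  by rewrite exprD ler_piMr ?exprn_ge0 ?invr_ge0// exprn_ile1 ?invr_ge0//; lra.
rewrite [X in _ <= X](_ : _ = 43 / 20 - e / 2); last first.
  by rewrite /e addSn exprS; lra.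
have : 2^-1 ^+ (K + 6 + 2) = e / 4 :> R.
  by rewrite /e exprD; field.
move: h IH; rewrite -/e; lra.
Qed.

(* One of the two integers next to [u] does at least as well as their average
   with mean [u], whose variance is at most 1/4. *)
Lemma round_concave_quadratic (a c u : R) (K : nat) : 0 <= c -> `|u| <= K%:R ->
  exists2 k : 'I_K.*2.+1, a * u - c * (u ^+ 2 + 4^-1)
    <= a * (k%:R - K%:R) - c * (k%:R - K%:R) ^+ 2
  & (grid_dist K k ^ 2)%:R = (k%:R - K%:R) ^+ 2 :> R.
Proof.
move=> c0; rewrite ler_norml => /andP[uK Ku].
have dist (k : nat) : (grid_dist K k ^ 2)%:R = (k%:R - K%:R) ^+ 2 :> R.
  rewrite /grid_dist natrX; have [kK|/ltnW Kk] := leqP k K.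
    rewrite (_ : (k - K)%N = 0%N); last by lia.
    by rewrite add0n natrB//; ring.
  rewrite (_ : (K - k)%N = 0%N); last by lia.
  by rewrite addn0 natrB.
have ge0 : 0 <= u + K%:R by lra.
pose n := Num.truncn (u + K%:R).
have /andP[n1 n2] := truncn_itv ge0.
rewrite -/n in n1 n2.
have nK : (n <= K.*2)%N.
  by rewrite -(ler_nat R); apply: le_trans n1 _; rewrite -addnn natrD lerD2r.
have [good|bad] := leP (a * u - c * (u ^+ 2 + 4^-1))
    (a * (n%:R - K%:R) - c * (n%:R - K%:R) ^+ 2).
  by exists (Ordinal (nK : n < K.*2.+1)%N).
have n1lt : n%:R < u + K%:R.
  rewrite lt_def n1 andbT; apply/eqP => e; move: bad.
  rewrite (_ : n%:R - K%:R = u) ?ltNge; last by lra.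
  by rewrite lerB// ler_wpM2l//; lra.
have nK' : (n < K.*2)%N.
  rewrite -(ltr_nat R); apply: lt_le_trans n1lt _.
  by rewrite -addnn natrD lerD2r.
exists (Ordinal (nK' : n.+1 < K.*2.+1)%N); rewrite //=.
rewrite -natr1 in n2 *; pose m : R := n%:R - K%:R.
have -> : n%:R + 1 - K%:R = m + 1 by rewrite /m; ring.
rewrite -/m in bad.
have p0 : 0 < u - m by rewrite /m; lra.
have p1 : u - m < 1 by rewrite /m; lra.
have h : 0 <= c * (u - m - 2^-1) ^+ 2 by rewrite mulr_ge0 ?sqr_ge0.
have uE : u = m + (u - m) by ring.
move: bad p0 p1 h uE; move: (u - m) => p bad p0 p1 h uE.
rewrite uE in bad *.
rewrite -(ler_pM2l p0).
have : (1 - p) * (a * m - c * m ^+ 2) <= (1 - p) * (a * (m + p) - c * ((m + p) ^+ 2 + 4^-1)).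
  by rewrite ler_wpM2l//; lra.
nra.
Qed.

End Grid.

(** * Measurability of matrix-valued maps and of uncountable conditions *)

Section MeasurableMatrices.
Context {R : realType}.

Lemma rat_mx_dense m n (M : 'M[R]_(m, n)) (e : R) : 0 < e ->
  exists q : 'M[rat]_(m, n), forall i j, `|M i j - ratr (q i j)| < e.
Proof.
move=> e0.
have h i j : exists q : rat, `|M i j - ratr q| < e.
  have /rat_in_itvoo[q] : M i j - e < M i j + e by lra.
  by rewrite in_itv/= => /andP[q1 q2]; exists q; rewrite ltr_norml; apply/andP; split; lra.
pose q i j := projT1 (cid (h i j)).
exists (\matrix_(i, j) q i j) => i j; rewrite mxE /q.
by case: cid.
Qed.

Context {disp : measure_display} {T : measurableType disp}.

(** Measurability of [X] is entrywise, so the open preimage is written as a countable union of the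
    rational boxes it contains. *)
Lemma measurable_continuous_mx m n (X : T -> 'M[R]_(m, n)) (F : 'M[R]_(m, n) -> R) :
  measurable_mx X -> continuous F -> measurable_fun setT (F \o X).
Proof.
move=> mX cF.
apply: (measurability _ (RGenOInfty.measurableE R)).
move=> _ [_ [a ->] <-]; rewrite setTI.
pose U : set 'M[R]_(m, n) := F @^-1` `]a, +oo[%classic.
have oU : open U by apply: open_comp => //; exact: rray_open.
pose box (qe : 'M[rat]_(m, n) * rat) : set 'M[R]_(m, n) :=
  [set N | forall i j, `|N i j - ratr (qe.1 i j)| < ratr qe.2].
have -> : (F \o X) @^-1` `]a, +oo[%classic =
    \bigcup_(qe : 'M[rat]_(m, n) * rat) (if `[< box qe `<=` U >] then X @^-1` box qe else set0).
  apply/seteqP; split => w /=.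
    move=> Uw; have : nbhs (X w) U by apply: open_nbhs_nbhs; split.
    move=> /nbhs_ballP[e /= e0 eU].
    have /rat_in_itvoo[r] : 0 < e / 2 by lra.
    rewrite in_itv/= => /andP[r0 re].
    have [q hq] := rat_mx_dense (X w) r0.
    exists (q, r) => //; case: asboolP => [_ //|]; apply.
    move=> N /= Nq; apply: eU; split => // i j.
    rewrite /ball /= (le_lt_trans (ler_distD (ratr (q i j)) _ _))//.
    have := hq i j; have := Nq i j; rewrite (distrC (N i j)); lra.
  by move=> [qe _]; case: asboolP => // h; exact: h.
apply: countable_bigcupT_measurable => // qe.
case: asboolP => // _.
have -> : X @^-1` box qe = \bigcap_(ij in [set: 'I_m * 'I_n])
    [set w | `|X w ij.1 ij.2 - ratr (qe.1 ij.1 ij.2)| < ratr qe.2].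
  apply/seteqP; split => w /= h; first by move=> ij _; exact: h.
  by move=> i j; exact: (h (i, j)).
apply: fin_bigcap_measurable => // ij _.
rewrite -[X in measurable X]setTI.
have mf : measurable_fun setT (fun w => `|X w ij.1 ij.2 - ratr (qe.1 ij.1 ij.2)| < ratr qe.2).
  apply: measurable_fun_ltr => //; apply: measurableT_comp => //.
  by apply: measurable_funB => //; exact: mX.
exact: (mf measurableT [set true]).
Qed.

(** By continuity in [z], a violation at some [z] is a violation at a rational vector, so the
    quantifier becomes countable. *)
Lemma measurable_forall_continuous n (F : T -> 'cV[R]_n -> R) :
  (forall z, measurable_fun setT (F^~ z)) -> (forall w, continuous (F w)) ->
  measurable [set w | forall z, 0 <= F w z].
Proof.
move=> mF cF.
have -> : [set w | forall z, 0 <= F w z] =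
    ~` \bigcup_(q : 'cV[rat]_n) [set w | F w (map_mx ratr q) < 0].
  apply/seteqP; split => w /=.
    by move=> h [q _] /=; rewrite ltNge h.
  move=> h z; rewrite leNgt; apply/negP => Fz; apply: h.
  have : nbhs z (F w @^-1` `]-oo, 0[%classic).
    apply: open_nbhs_nbhs; split; last by rewrite /= in_itv.
    by apply: open_comp => //; exact: lray_open.
  move=> /nbhs_ballP[e /= e0 eU].
  have [q hq] := rat_mx_dense z e0.
  exists q => //=; have : ball z e (map_mx ratr q).
    by split => // i j; rewrite mxE; exact: hq.
  by move/eU; rewrite /= in_itv.
apply: measurableC; apply: countable_bigcupT_measurable => // q.
rewrite -[X in measurable X]setTI.
have mf : measurable_fun setT (fun w => F w (map_mx ratr q) < 0).
  by apply: measurable_fun_ltr.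
exact: (mf measurableT [set true]).
Qed.

Lemma measurable_mx_mul m n k (X : T -> 'M[R]_(m, n)) (Y : T -> 'M[R]_(n, k)) :
  measurable_mx X -> measurable_mx Y -> measurable_mx (fun w => X w *m Y w).
Proof.
move=> mX mY i j; under eq_fun do rewrite mxE.
by apply: measurable_sum => a; exact: measurable_funM.
Qed.

Lemma measurable_mx_tr m n (X : T -> 'M[R]_(m, n)) :
  measurable_mx X -> measurable_mx (fun w => (X w)^T).
Proof. by move=> mX i j; under eq_fun do rewrite mxE; exact: mX. Qed.

Lemma measurable_mx_cst m n (A : 'M[R]_(m, n)) : measurable_mx (fun _ : T => A).
Proof. by move=> i j. Qed.

Lemma measurable_mxD m n (X Y : T -> 'M[R]_(m, n)) :
  measurable_mx X -> measurable_mx Y -> measurable_mx (fun w => X w + Y w).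
Proof. by move=> mX mY i j; under eq_fun do rewrite mxE; exact: measurable_funD. Qed.

Lemma measurable_dot n (X Y : T -> 'cV[R]_n) :
  measurable_mx X -> measurable_mx Y -> measurable_fun setT (fun w => dot (X w) (Y w)).
Proof.
by move=> mX mY; apply: measurable_sum => i; exact: measurable_funM.
Qed.

Lemma continuous_sum_real (U : topologicalType) (I : Type) (r : seq I) (F : I -> U -> R) :
  (forall i, continuous (F i)) -> continuous (fun z => \sum_(i <- r) F i z).
Proof.
move=> cF; elim: r => [|i r IH] z.
  by under eq_fun do rewrite big_nil; exact: cvg_cst.
by under eq_fun do rewrite big_cons; apply: cvgD; [exact: cF|exact: IH].
Qed.

Lemma continuous_dot_mulmx m n (A : 'M[R]_(m, n)) :
  continuous (fun z : 'cV[R]_n => dot (A *m z) (A *m z)).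
Proof.
have cA i : continuous (fun z : 'cV[R]_n => (A *m z) i 0).
  under eq_fun do rewrite mxE.
  apply: continuous_sum_real => j z.
  apply: (continuous_comp (g := *%R (A i j))); first exact: coord_continuous.
  exact: mulrl_continuous.
rewrite /dot; apply: (continuous_sum_real (F := fun i z => (A *m z) i 0 * (A *m z) i 0)).
by move=> i z; apply: cvgM; [exact: nbhs_filter|exact: cA|exact: cA].
Qed.

End MeasurableMatrices.

(** * The operator norm of a scaled Gaussian matrix *)

Section GaussianOpnorm.
Context {R : realType}.

Definition grid_point (d : nat) (h : R) (K : nat) (g : {ffun 'I_d -> 'I_K.*2.+1}) : 'cV[R]_d :=
  \col_i (h * ((g i)%:R - K%:R)).

(** Minus the logarithm of the weight of a grid point, the product over coordinates of
    [2^(-k^2) / (43/20)]. *)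
Definition grid_cost (d K : nat) (g : {ffun 'I_d -> 'I_K.*2.+1}) : R :=
  \sum_i ((grid_dist K (g i) ^ 2)%:R * ln 2 + ln (43 / 20)).

(** The first term pays for the failure probability 1/16, the second for the grid. *)
Definition opnorm_rate (l d : nat) : R := 2 * ln 16 / l%:R + 8 / 3 * d%:R / l%:R.

Lemma ln16_gt0 : 0 < ln 16 :> R.
Proof. by rewrite ln_gt0//; lra. Qed.

(* AM-GM makes the bound on [enorm (A *m y)] affine in [dot y y], so that it
   passes from grid points to [w] by rounding each coordinate. *)
Lemma grid_opnorm_bound (l d : nat) (A : 'M[R]_(l, d.+1)) (w : 'cV[R]_d.+1) :
  (0 < l)%N ->
  let E := opnorm_rate l d.+1 in
  let b := 3 / 2 / Num.sqrt E in
  (forall g : {ffun 'I_d.+1 -> 'I_d.+2.*2.+1},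
    let y := grid_point (Num.sqrt (2 / d.+1%:R)) g in
    l%:R / 2 * dot (A *m y) (A *m y) / (b + dot y y) - l%:R * dot y y / (2 * b)
      <= ln 16 + grid_cost g) ->
  enorm w <= 1 ->
  enorm (A *m w) <= Num.sqrt (3 / 2) * (1 + Num.sqrt E).
Proof.
move=> l0 E b H w1.
have lR : 0 < l%:R :> R by rewrite ltr0n.
have L16 := ln16_gt0.
have dd0 : 0 < d.+1%:R :> R by rewrite ltr0n.
have E0 : 0 < E.
  apply: ltr_pwDl; first by rewrite divr_gt0// mulr_gt0.
  by rewrite !mulr_ge0// invr_ge0.
set e := Num.sqrt E; have e0 : 0 < e by rewrite sqrtr_gt0.
have eE : E = e ^+ 2 by rewrite sqr_sqrtr// ltW.
set r := Num.sqrt (3 / 2); have r0 : 0 < r by rewrite sqrtr_gt0; lra.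
have r2 : r ^+ 2 = 3 / 2 by rewrite sqr_sqrtr//; lra.
have b0 : 0 < b by rewrite /b divr_gt0//; lra.
pose D : R := d.+1%:R / l%:R.
have D0 : 0 <= D by rewrite divr_ge0.
pose h : R := Num.sqrt (2 / d.+1%:R).
have h0 : 0 < h by rewrite sqrtr_gt0 divr_gt0.
have h2 : h ^+ 2 = 2 / d.+1%:R by rewrite sqr_sqrtr// divr_ge0.
(* At [dot y y = 3/2] the two factors are [b + 3/2] and [3/(2b) + E]. The choice [b = 3/(2e)]
   minimises their product, to [3/2 (1 + e)^2], and [mu] is the root of their quotient, where AM-GM
   is an equality. *)
pose mu := e / r; have mu0 : 0 < mu by rewrite divr_gt0.
pose L2 : R := ln 2; have L20 : 0 <= L2 by rewrite ln_ge0//; lra.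
pose Lt : R := ln (43 / 20).
pose t : R := 2 * ln 16 / l%:R.
have [->|Aw0] := eqVneq (enorm (A *m w)) 0.
  by rewrite mulr_ge0 ?addr_ge0 ?sqrtr_ge0.
have Awp : 0 < enorm (A *m w) by rewrite lt_def Aw0 enorm_ge0.
(* The unit vector [v] linearises the norm: [dot a] equals it at [w] and is below it at [y], so
   coordinates can be rounded separately. *)
pose v := (enorm (A *m w))^-1 *: (A *m w).
have v1 : enorm v = 1 by rewrite enormZ ger0_norm ?invr_ge0 ?enorm_ge0// mulVf.
pose a := A^T *m v.
have aw : dot a w = enorm (A *m w).
  by rewrite /a dot_mulmx trmxK /v dotZl -enorm_sqr expr2 mulrA mulVf// mul1r.
(* The coefficient of [dot y y] in the AM-GM bound; subtracting [c * dot y y] cancels all dependence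
   on the grid point. *)
pose c := (mu + (b^-1 + D * L2) / mu) / 2.
have c0 : 0 <= c.
  by rewrite divr_ge0// addr_ge0 ?ltW// divr_gt0// ltr_pwDl ?invr_gt0// mulr_ge0.
have [g hg] : exists g : {ffun 'I_d.+1 -> 'I_d.+2.*2.+1},
    forall i, (a i 0 * w i 0 - c * (w i 0 ^+ 2 + h ^+ 2 / 4) <=
      a i 0 * grid_point h g i 0 - c * grid_point h g i 0 ^+ 2) /\
      h ^+ 2 * (grid_dist d.+2 (g i) ^ 2)%:R = grid_point h g i 0 ^+ 2.
  have R1 i : exists k : 'I_d.+2.*2.+1,
      (a i 0 * w i 0 - c * (w i 0 ^+ 2 + h ^+ 2 / 4) <=
      a i 0 * (h * (k%:R - d.+2%:R)) - c * (h * (k%:R - d.+2%:R)) ^+ 2) /\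
      h ^+ 2 * (grid_dist d.+2 k ^ 2)%:R = (h * (k%:R - d.+2%:R)) ^+ 2.
    have wi : `|w i 0| <= 1.
      have : `|w i 0| ^+ 2 <= 1.
        rewrite real_normK ?num_real//.
        apply: (@le_trans _ _ (enorm w ^+ 2)); last by rewrite exprn_ile1 ?enorm_ge0.
        rewrite enorm_sqr /dot (bigD1 i)//= -expr2 lerDl sumr_ge0// => j _.
        by rewrite -expr2 sqr_ge0.
      by rewrite expr_le1.
    (* As [1 / h = sqrt (d.+1 / 2)] is below [d.+2], the grid covers the unit ball. A generous
       radius is harmless, since the total weight is bounded uniformly in it. *)
    have uK : `|w i 0 / h| <= d.+2%:R.
      rewrite normf_div (gtr0_norm h0) ler_pdivrMr//.
      apply: le_trans wi _.
      rewrite -(@ler_pXn2r _ 2) ?nnegrE ?mulr_ge0 ?(ltW h0)// expr1n exprMn h2.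
      rewrite mulrA ler_pdivlMr// mul1r -natrX -natrM ler_nat.
      by rewrite (@leq_trans (d.+2 ^ 2))// ?leq_pmulr// expnS expn1 (leq_trans _ (leq_pmulr _ _)).
    have [k k1 k2] := round_concave_quadratic (a i 0 * h) (mulr_ge0 c0 (sqr_ge0 h)) uK.
    exists k; split; last by rewrite k2 exprMn.
    move: k1; rewrite exprMn exprVn.
    have -> : a i 0 * h * (w i 0 / h) = a i 0 * w i 0.
      by field; rewrite gt_eqF.
    have -> : c * h ^+ 2 * (w i 0 ^+ 2 / h ^+ 2 + 4^-1) = c * (w i 0 ^+ 2 + h ^+ 2 / 4).
      by field; rewrite gt_eqF.
    by rewrite exprMn; lra.
  exists [ffun i => projT1 (cid (R1 i))] => i.
  have gridE (g : {ffun 'I_d.+1 -> 'I_d.+2.*2.+1}) :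
    grid_point h g i 0 = h * ((g i)%:R - d.+2%:R) by rewrite mxE.
  by rewrite !gridE !ffunE; exact: (projT2 (cid (R1 i))).
set y := grid_point h g in hg.
pose Y := dot y y.
have Y0 : 0 <= Y by exact: dot_ge0.
(* The [d.+1] coordinates each lose [h ^+ 2 / 4]; the mesh makes the sum of these errors exactly
   1/2. *)
have round : dot a w - c * (dot w w + 2^-1) <= dot a y - c * Y.
  have -> : c * (dot w w + 2^-1) = \sum_(i < d.+1) c * (w i 0 ^+ 2 + h ^+ 2 / 4).
    rewrite -mulr_sumr big_split /= sumr_const card_ord h2; congr (_ * (_ + _)).
    by rewrite -[RHS]mulr_natr; move: (d.+1%:R : R) dd0 => dd dd0; field; rewrite gt_eqF.
  rewrite /Y /dot mulr_sumr -!sumrB; apply: ler_sum => i _.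
  by have [] := hg i; rewrite !expr2.
have cost : grid_cost g = d.+1%:R * (Y / 2 * L2 + Lt).
  rewrite /grid_cost big_split /= sumr_const card_ord -mulr_suml -[X in _ + X]mulr_natl.
  rewrite mulrDr; congr (_ + _); rewrite mulrA; congr (_ * _).
  have : h ^+ 2 * (\sum_i (grid_dist d.+2 (g i) ^ 2)%:R) = Y.
    by rewrite mulr_sumr /Y /dot; apply: eq_bigr => i _; have [_ ->] := hg i; rewrite expr2.
  move=> <-; rewrite h2; move: (d.+1%:R : R) dd0 => dd dd0.
  by field; rewrite gt_eqF.
have Hg : dot (A *m y) (A *m y) <= (b + Y) * (Y / b + t + D * (2 * Lt + L2 * Y)).
  have bY : 0 < b + Y by rewrite ltr_pwDl.
  have := H g; rewrite /= -/h -/y -/Y cost => h1.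
  rewrite -ler_pdivrMl//.
  set q := _ * dot _ _.
  have h3 : l%:R / 2 * q <= l%:R * Y / (2 * b) + (ln 16 + d.+1%:R * (Y / 2 * L2 + Lt)).
    have qE : l%:R / 2 * dot (A *m y) (A *m y) / (b + Y) = l%:R / 2 * q.
      by rewrite /q; ring.
    by rewrite -qE; lra.
  rewrite -(ler_pM2l (_ : 0 < l%:R / 2)) ?divr_gt0//.
  apply: le_trans h3 _; rewrite le_eqVlt; apply/orP; left; apply/eqP.
  rewrite /t /D; move: (d.+1%:R : R) => dd; by field; rewrite !gt_eqF.
have Ay : enorm (A *m y) <= (mu * (b + Y) + (Y / b + t + D * (2 * Lt + L2 * Y)) / mu) / 2.
  set p := b + Y in Hg *; set q := Y / b + _ + _ in Hg *.
  have p0 : 0 < p by rewrite ltr_pwDl.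
  have q0 : 0 <= q by rewrite -(pmulr_rge0 _ p0) (le_trans _ Hg)// dot_ge0.
  have m0 : 0 <= (mu * p + q / mu) / 2.
    by rewrite divr_ge0// addr_ge0// ?mulr_ge0 ?invr_ge0// ltW.
  rewrite -(@ler_pXn2r _ 2) ?nnegrE ?enorm_ge0// enorm_sqr.
  apply: le_trans Hg _; rewrite -subr_ge0.
  have -> : ((mu * p + q / mu) / 2) ^+ 2 - p * q = ((mu * p - q / mu) / 2) ^+ 2.
    by field; rewrite gt_eqF.
  exact: sqr_ge0.
have ay : dot a y <= enorm (A *m y).
  rewrite /a dot_mulmx trmxK; apply: le_trans (cauchy_schwarz _ _) _.
  by rewrite v1 mul1r.
have w2 : dot w w <= 1 by rewrite -enorm_sqr exprn_ile1 ?enorm_ge0.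
have ent : 2 * Lt + 3 / 2 * L2 <= 8 / 3 by exact: grid_entropy_bound.
have EtD : E = t + 8 / 3 * D by rewrite /E /opnorm_rate /t /D mulrA.
have : enorm (A *m w) <= (mu * (b + 3 / 2) + (3 / 2 / b + E) / mu) / 2.
  rewrite -aw.
  have h4 : c * (dot w w + 2^-1) <= c * (3 / 2) by rewrite ler_wpM2l//; lra.
  have h5 : dot a w <= (mu * (b + Y) + (Y / b + t + D * (2 * Lt + L2 * Y)) / mu) / 2
     - c * Y + c * (3 / 2) by lra.
  apply: le_trans h5 _.
  have -> : (mu * (b + Y) + (Y / b + t + D * (2 * Lt + L2 * Y)) / mu) / 2
     - c * Y + c * (3 / 2) =
     (mu * (b + 3 / 2) + (3 / 2 / b + t + D * (2 * Lt + 3 / 2 * L2)) / mu) / 2.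
    by rewrite /c; field; rewrite !gt_eqF.
  rewrite ler_pM2r ?invr_gt0// lerD2l ler_pM2r ?invr_gt0// EtD -!addrA lerD2l lerD2l.
  by rewrite mulrC ler_wpM2r.
move=> /le_trans; apply; rewrite le_eqVlt; apply/orP; left; apply/eqP.
rewrite /b -/e /mu eE.
have -> : (e / r * (3 / 2 / e + 3 / 2) + (3 / 2 / (3 / 2 / e) + e ^+ 2) / (e / r)) / 2
   = ((3 / 2) / r + r) / 2 * (1 + e).
  by field; rewrite !gt_eqF.
rewrite -r2; field; by rewrite gt_eqF.
Qed.

End GaussianOpnorm.

Section GaussianOpnormProbability.
Context {R : realType} {disp : measure_display} {T : measurableType disp}.
Variable P : probability T R.

(** Markov's inequality, for the complement. *)
Lemma probability_lt_ge (Y : T -> R) (a : R) : 0 < a ->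
  measurable_fun setT Y -> (forall w, 0 <= Y w) ->
  (\int[P]_w (Y w)%:E <= 1)%E ->
  ((1 - a^-1)%:E <= P [set w | (Y w < a)%R])%E.
Proof.
move=> a0 mY Y0 Y1.
have mlt : measurable [set w | Y w < a].
  rewrite -[X in measurable X]setTI.
  have mf : measurable_fun setT (fun w => Y w < a) by exact: measurable_fun_ltr.
  exact: (mf measurableT [set true]).
have : (a%:E * P (~` [set w | (Y w < a)%R]) <= 1)%E.
  apply: le_trans Y1.
  rewrite -[X in P X](setIT (~` [set w | Y w < a])) -integral_indic//; last exact: measurableC.
  rewrite -ge0_integralZl_EFin//; last 2 first.
  - by apply/measurable_EFinP; apply: measurable_indic; exact: measurableC.
  - exact: ltW.
  apply: ge0_le_integral => //=.
  - by move=> w _; rewrite lee_fin mulr_ge0 ?(ltW a0).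
  - by apply/measurable_EFinP; apply: measurable_funM => //; apply: measurable_indic; exact: measurableC.
  - exact/measurable_EFinP.
  move=> w _; rewrite lee_fin indicE; have [/set_mem/= h|_] := boolP (w \in _).
    by rewrite mulr1 leNgt; apply/negP.
  by rewrite mulr0.
rewrite probability_setC//.
rewrite -(fineK (fin_num_measure P _ mlt)); move: (fine _) => p.
by rewrite -EFinB -EFinM !lee_fin mulrC -ler_pdivlMr// div1r; lra.
Qed.

Lemma measurable_opnorm_event (l d : nat) (S : T -> 'M[R]_(l, d)) (B : R) :
  measurable_mx S -> 0 <= B ->
  measurable [set w | forall z, enorm (S w *m z) <= B * enorm z].
Proof.
move=> mS B0.
(* Squaring gives quadratic forms in [z]; writing [z] as [1%:M *m z] lets one continuity lemma treat
   both. *)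
have -> : [set w | forall z, enorm (S w *m z) <= B * enorm z] =
    [set w | forall z, 0 <= B ^+ 2 * dot (1%:M *m z) (1%:M *m z) - dot (S w *m z) (S w *m z)].
  apply/seteqP; split => w /= h z; have := h z.
    rewrite subr_ge0 mul1mx -!enorm_sqr -exprMn => hz.
    by apply: lerXn2r => //; rewrite nnegrE ?mulr_ge0 ?enorm_ge0.
  by rewrite subr_ge0 mul1mx -!enorm_sqr -exprMn ler_pXn2r// nnegrE ?mulr_ge0 ?enorm_ge0.
apply: measurable_forall_continuous => [z|w].
  apply: measurable_funB => //; apply: measurable_dot; apply: measurable_mx_mul => //;
    exact: measurable_mx_cst.
have c1 : continuous (fun z : 'cV[R]_d => B ^+ 2 * dot (1%:M *m z) (1%:M *m z)).
  move=> z; apply: (continuous_comp (f := fun z : 'cV[R]_d => dot (1%:M *m z) (1%:M *m z)) (g := *%R (B ^+ 2))); last exact: mulrl_continuous.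
  exact: continuous_dot_mulmx.
move=> z; apply: cvgB; [exact: nbhs_filter|exact: c1|exact: continuous_dot_mulmx].
Qed.

(** The union bound is a single application of Markov: the weighted sum [Y] of the exponentials has
    mean at most 1, and [Y < 16] bounds every term at once, each at its own cost. *)
Lemma scaled_gaussian_opnorm (l d : nat) (S : T -> 'M[R]_(l, d)) :
  (0 < l)%N -> scaled_gaussian P S ->
  ((1 - 16^-1)%:E <= P [set w | forall z,
     (enorm (S w *m z) <= Num.sqrt (3 / 2) * (1 + Num.sqrt (opnorm_rate l d)) * enorm z)%R])%E.
Proof.
move=> l0 gS; have [mS _ _] := gS.
have B0 : 0 <= Num.sqrt (3 / 2) * (1 + Num.sqrt (opnorm_rate l d : R)).
  by rewrite mulr_ge0 ?addr_ge0 ?sqrtr_ge0.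
(* In dimension 0 the mesh [sqrt (2 / d)] makes no sense, and the only vector is 0. *)
case: d => [|d] in S gS mS B0 *.
  rewrite (_ : [set w | _] = setT) ?probability_setT ?lee_fin; first lra.
  apply/seteqP; split => // w _ z /=.
  have -> : z = 0 by apply/matrixP => -[].
  by rewrite mulmx0 !enorm0 mulr0.
set B := _ * (1 + _).
set E : R := opnorm_rate l d.+1 in B B0 *.
pose b : R := 3 / 2 / Num.sqrt E.
have E0 : 0 < E.
  apply: ltr_pwDl; first by rewrite divr_gt0 ?mulr_gt0 ?ltr0n// ln16_gt0.
  by rewrite !mulr_ge0// invr_ge0.
have b0 : 0 < b by rewrite divr_gt0 ?sqrtr_gt0//; lra.
pose gp (g : {ffun 'I_d.+1 -> 'I_d.+2.*2.+1}) : 'cV[R]_d.+1 :=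
  grid_point (Num.sqrt (2 / d.+1%:R)) g.
pose expo (y : 'cV[R]_d.+1) w := l%:R / 2 * dot (S w *m y) (S w *m y) / (b + dot y y)
     - l%:R * dot y y / (2 * b).
have mexpo y : measurable_fun setT (fun w => expR (expo y w)).
  apply: measurableT_comp => //; apply: measurable_funB => //.
  apply: measurable_funM => //; apply: measurable_funM => //.
  by apply: measurable_dot; apply: measurable_mx_mul => //; exact: measurable_mx_cst.
pose Y w := \sum_(g : {ffun 'I_d.+1 -> 'I_d.+2.*2.+1})
  expR (- grid_cost (R:=R) g) * expR (expo (gp g) w).
have mY : measurable_fun setT Y.
  by apply: measurable_sum => g; exact: measurable_funM.
have Y0 w : 0 <= Y w by apply: sumr_ge0 => g _; rewrite mulr_ge0 ?expR_ge0.
have Y1 : (\int[P]_w (Y w)%:E <= 1)%E.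
  rewrite /Y; under eq_integral do rewrite -sumEFin.
  rewrite ge0_integral_sum//; last by move=> g; apply/measurable_EFinP; exact: measurable_funM.
  apply: (@le_trans _ _ (\sum_(g : {ffun 'I_d.+1 -> 'I_d.+2.*2.+1}) (expR (- grid_cost (R:=R) g))%:E)%E).
    apply: lee_sum => g _; under eq_integral do rewrite EFinM.
    rewrite ge0_integralZl_EFin ?expR_ge0//; last exact/measurable_EFinP.
    rewrite -[leRHS]mule1 lee_wpmul2l ?lee_fin ?expR_ge0//.
    exact: scaled_gaussian_norm_mgf.
  rewrite sumEFin lee_fin.
  have costE (g : {ffun 'I_d.+1 -> 'I_d.+2.*2.+1}) : expR (- grid_cost (R:=R) g) =
      \prod_i (2^-1 ^+ (grid_dist d.+2 (g i) ^ 2) / (43 / 20)).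
    rewrite /grid_cost -sumrN expR_sum; apply: eq_bigr => i _.
    rewrite opprD expRD; congr (_ * _); last first.
      by rewrite expRN lnK ?posrE//; lra.
    rewrite expRN expRM_natl lnK ?posrE//.
    by rewrite exprVn.
  under eq_bigr do rewrite costE.
  (* The weights factor over coordinates, so their total is the power [d.+1] of a one-dimensional
     sum, which is at most 1. *)
  rewrite -(bigA_distr_bigA (fun (_ : 'I_d.+1) (k : 'I_d.+2.*2.+1) => 2^-1 ^+ (grid_dist d.+2 k ^ 2) / (43 / 20))).
  rewrite /= prodr_const card_ord exprn_ile1//.
    by apply: sumr_ge0 => k _; rewrite divr_ge0 ?exprn_ge0 ?invr_ge0//; lra.
  rewrite -mulr_suml ler_pdivrMr ?mul1r; last lra.
  apply: le_trans (grid_sum_le d) _.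
  by rewrite gerBl exprn_ge0// invr_ge0.
have h16 : 0 < 16 :> R by [].
apply: le_trans (probability_lt_ge h16 mY Y0 Y1) _.
apply: le_measure; rewrite ?inE.
- rewrite -[X in measurable X]setTI.
  have mf : measurable_fun setT (fun w => Y w < 16) by exact: measurable_fun_ltr.
  exact: (mf measurableT [set true]).
- exact: measurable_opnorm_event.
move=> w /= Yw.
have Hg g : expo (gp g) w <= ln 16 + grid_cost (R:=R) g.
  have : expR (- grid_cost (R:=R) g) * expR (expo (gp g) w) <= 16.
    apply: le_trans (ltW Yw); rewrite /Y (bigD1 g)//= lerDl.
    by apply: sumr_ge0 => g' _; rewrite mulr_ge0 ?expR_ge0.
  rewrite -expRD -[leRHS]lnK ?posrE// ler_expR; lra.
move=> z.
have [z0|z0] := eqVneq (enorm z) 0.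
  by rewrite (enorm_eq0 z0) mulmx0 !enorm0 mulr0.
have zp : 0 < enorm z by rewrite lt_def z0 enorm_ge0.
have := @grid_opnorm_bound R l d (S w) ((enorm z)^-1 *: z) l0 Hg.
rewrite -scalemxAr !enormZ ger0_norm ?invr_ge0 ?enorm_ge0// mulVf// => /(_ (lexx _)) h.
by rewrite -ler_pdivrMr// mulrC; exact: h.
Qed.

End GaussianOpnormProbability.

(** * One iteration: success for small [alpha], and decrease under a good sketch *)

Section Iteration.
Context {R : realType}.

Definition embeds (l d : nat) (S : 'M[R]_(l, d)) (M : 'M[R]_(d, d.+1)) : Prop :=
  forall z : 'cV[R]_d.+1, (1 - 2^-1) * enorm (M *m z) ^+ 2 <= enorm (S *m M *m z) ^+ 2.

(** Applied to the column [(1, s)] it gives [grad + hess s], so one embedding covers all steps,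
    including one chosen after the sketch. *)
Definition derivative_mx (d : nat) (f : 'cV[R]_d -> R) (x : 'cV[R]_d) : 'M[R]_(d, d.+1) :=
  row_mx (grad f x) (hess f x).

(** Stated with a quantifier over [z] rather than a [sup], which suits the measurability
    argument. *)
Definition norm_bounded (l d : nat) (S : 'M[R]_(l, d)) (B : R) : Prop :=
  forall z, enorm (S *m z) <= B * enorm z.

Variables (d l : nat) (f : 'cV[R]_d -> R) (LH : R).
Hypothesis hf : twice_continuously_differentiable f.
Hypothesis hLH : 0 < LH.
Hypothesis hLip : lipschitz_hessian f LH.
Variables (theta kappaT alphamax : R).
Hypothesis htheta : 0 < theta < 1.
Hypothesis hkappaT : 0 <= kappaT.
Variables (x : 'cV[R]_d) (S : 'M[R]_(l, d)) (shat : 'cV[R]_l) (alpha : R).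
Hypothesis halpha : 0 < alpha <= alphamax.
Let s := S^T *m shat.
Hypothesis hdec : mhat f x alpha S shat <= mhat f x alpha S 0.

Lemma qhatE : qhat f x S shat = f x + dot (grad f x) s + 2^-1 * dot s (hess f x *m s).
Proof.
rewrite /qhat dot_mulmx -/s; congr (_ + _ + _ * _).
by rewrite -!mulmxA -/s -[RHS]dotC -{1}[S]trmxK -dot_mulmx dotC.
Qed.

Lemma qhat0 : qhat f x S 0 = f x.
Proof. by rewrite /qhat dot0r dot0l mulr0 !addr0. Qed.

Lemma model_decrease : (3 * alpha)^-1 * enorm s ^+ 3 <= qhat f x S 0 - qhat f x S shat.
Proof.
by move: hdec; rewrite /mhat mulmx0 enorm0 expr0n /= mulr0 addr0 -/s; lra.
Qed.

(** The Taylor error [LH / 6 * |s|^3] is then at most the fraction [1 - theta] of the guaranteed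
    model decrease [|s|^3 / (3 alpha)]. *)
Lemma small_alpha_success : alpha <= 2 * (1 - theta) / LH ->
  sufficient_decrease f theta x S shat.
Proof.
move=> asmall; rewrite /sufficient_decrease -/s qhat0.
have [a0 _] := andP halpha; have [t0 t1] := andP htheta.
have := model_decrease; rewrite qhat0 => md.
have tl := taylor_le hf hLip x s; rewrite -qhatE in tl.
have s3 : 0 <= enorm s ^+ 3 by rewrite exprn_ge0 ?enorm_ge0.
have : (1 - theta) * ((3 * alpha)^-1 * enorm s ^+ 3) <= (1 - theta) * (f x - qhat f x S shat).
  by rewrite ler_wpM2l//; lra.
have : LH / 6 * enorm s ^+ 3 <= (1 - theta) * ((3 * alpha)^-1 * enorm s ^+ 3).
  rewrite [leRHS]mulrA ler_wpM2r// ler_pdivlMr ?mulr_gt0//.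
  by move: asmall; rewrite ler_pdivlMr//; lra.
lra.
Qed.

Lemma success_monotone : sufficient_decrease f theta x S shat -> f (x + s) <= f x.
Proof.
rewrite /sufficient_decrease -/s => h; have [t0 t1] := andP htheta.
have [a0 _] := andP halpha.
have : 0 <= qhat f x S 0 - qhat f x S shat.
  apply: le_trans model_decrease.
  by rewrite mulr_ge0 ?invr_ge0 ?exprn_ge0 ?enorm_ge0// mulr_ge0// ltW.
by move/(mulr_ge0 (ltW t0)); lra.
Qed.

Hypothesis hstat : enorm (grad (mhat f x alpha S) shat) <= kappaT * enorm s ^+ 2.
Variables (eps B Smax a' : R).
Hypothesis heps : 0 < eps.
Hypothesis ha' : 0 < a' <= alpha.
Hypothesis hLa : LH / 2 <= a'^-1.
Hypothesis hemb : embeds S (derivative_mx f x).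
Hypothesis hnorm : norm_bounded S B.
Hypothesis hB0 : 0 <= B.
Hypothesis hB : 1 + Num.sqrt 2 * B <= 2 * Num.sqrt 2 * Smax.
Hypothesis hgrad : eps < enorm (grad f (x + s)).

(** The vector [y], the gradient of the quadratic Taylor model at the step, is the link: smoothness
    gives [eps < LH / 2 * |s|^2 + |y|], the embedding gives [|y| <= sqrt 2 * |S y|], and approximate
    stationarity bounds [|S y|] by a multiple of [|s|^2]. *)
Lemma step_lower_bound :
  eps / 2 * (Num.sqrt (1 / 2) / (1 / a' * Smax + kappaT)) <= enorm s ^+ 2.
Proof.
have [a0 _] := andP halpha; have [a'0 a'a] := andP ha'.
have hB' := hB; set r := Num.sqrt 2 in hB' *.
have r0 : 0 < r by rewrite sqrtr_gt0.
have r2 : r ^+ 2 = 2 by rewrite sqr_sqrtr.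
have rV : Num.sqrt (1 / 2) = r^-1 :> R by rewrite div1r sqrtrV.
have Smax0 : 0 < Smax.
  have : 0 < 2 * r * Smax.
    by apply: lt_le_trans hB'; rewrite ltr_wpDr// mulr_ge0// ltW.
  by rewrite pmulr_rgt0// mulr_gt0.
have s0 := enorm_ge0 s.
pose y := grad f x + hess f x *m s.
have yE : derivative_mx f x *m col_mx (const_mx 1 : 'cV_1) s = y.
  etransitivity; first exact: (mul_row_col (grad f x) (hess f x) (const_mx 1) s).
  congr (_ + _).
  by apply/matrixP => i j; rewrite mxE big_ord1 !mxE mulr1.
have e1 : enorm y <= r * enorm (S *m y).
  have := hemb (col_mx (const_mx 1 : 'cV_1) s); rewrite -mulmxA yE => h.
  rewrite -(@ler_pXn2r _ 2) ?nnegrE ?mulr_ge0 ?enorm_ge0 ?(ltW r0)// exprMn r2; lra.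
have e2 : enorm (S *m y) <= kappaT * enorm s ^+ 2 + alpha^-1 * B * enorm s ^+ 2.
  have Sy : S *m y = grad (mhat f x alpha S) shat - (enorm s / alpha) *: (S *m s).
    by rewrite (grad_mhat _ _ a0 (hess_sym hf hLip x (ltW hLH))) -/s addrK.
  rewrite Sy; apply: le_trans (enormD _ _) _; rewrite enormN enormZ lerD//.
  rewrite ger0_norm ?divr_ge0 ?(ltW a0)//.
  have -> : alpha^-1 * B * enorm s ^+ 2 = enorm s / alpha * (B * enorm s) by ring.
  by rewrite ler_wpM2l ?divr_ge0 ?(ltW a0).
have e3 : eps < LH / 2 * enorm s ^+ 2 + enorm y.
  apply: lt_le_trans hgrad _.
  have -> : grad f (x + s) = (grad f (x + s) - grad f x - hess f x *m s) + y.
    by rewrite -[_ - _ - _]addrA -opprD subrK.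
  apply: le_trans (enormD _ _) _; rewrite lerD2r.
  exact: grad_taylor hf hLip _ _ (ltW hLH).
have s20 : 0 <= enorm s ^+ 2 by rewrite sqr_ge0.
have ainv : alpha^-1 <= a'^-1 by rewrite lef_pV2 ?posrE.
have ai0 : 0 < a'^-1 by rewrite invr_gt0.
(* With [LH / 2] bounded by [1 / a'], the terms other than [kappaT] sum to at most
   [(1 + r * B) / a'], which [hB] absorbs; the [kappaT] term has a factor 2 to spare. *)
have e4 : eps <= 2 * r * (1 / a' * Smax + kappaT) * enorm s ^+ 2.
  apply: le_trans (ltW e3) _.
  apply: (@le_trans _ _ ((LH / 2 + r * (kappaT + alpha^-1 * B)) * enorm s ^+ 2)).
    rewrite mulrDl lerD2l; apply: le_trans e1 _.
    by rewrite -mulrA ler_pM2l//; lra.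
  rewrite ler_wpM2r//.
  have h1 : alpha^-1 * B <= a'^-1 * B by rewrite ler_wpM2r.
  have h2 : r * (kappaT + alpha^-1 * B) <= r * (kappaT + a'^-1 * B) by rewrite ler_pM2l// lerD2l.
  have h3 : a'^-1 * (1 + r * B) <= a'^-1 * (2 * r * Smax) by rewrite ler_pM2l.
  have h4 : 0 <= r * kappaT by rewrite mulr_ge0// ltW.
  have := hLa; rewrite div1r; move: h1 h2 h3.
  move: a'^-1 alpha^-1 => u v h1 h2 h3 h5; lra.
have D0 : 0 < 1 / a' * Smax + kappaT by rewrite ltr_wpDr// div1r mulr_gt0.
rewrite rV mulrA ler_pdivrMr// ler_pdivrMr//; lra.
Qed.

(** The minimum in [h_rarc] is bounded by its second entry, which is the previous bound raised to
    the power 3/2, as [|s|^3 = (|s|^2)^(3/2)]. *)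
Lemma success_decrease : sufficient_decrease f theta x S shat ->
  h_rarc theta alphamax LH Smax kappaT eps a' <= f x - f (x + s).
Proof.
rewrite /sufficient_decrease -/s => hs.
have [a0 aM] := andP halpha; have [t0 t1] := andP htheta.
have aM0 : 0 < alphamax by exact: lt_le_trans aM.
have slb := step_lower_bound.
have md := model_decrease.
apply: le_trans hs.
apply: le_trans (_ : theta * ((3 * alpha)^-1 * enorm s ^+ 3) <= _); last by rewrite ler_pM2l.
rewrite /h_rarc; set Q := Num.sqrt (1 / 2) / _ in slb *.
apply: (@le_trans _ _ (theta / (3 * alphamax) * (eps / 2) `^ (3 / 2) * Q `^ (3 / 2))).
  rewrite ler_wpM2l ?ge_min ?lexx ?orbT// mulr_ge0 ?powR_ge0// divr_ge0 ?(ltW t0)//.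
  by rewrite mulr_ge0// ltW.
have Q0 : 0 <= Q.
  have [a'0 _] := andP ha'.
  rewrite divr_ge0 ?sqrtr_ge0// addr_ge0// mulr_ge0 ?divr_ge0 ?(ltW a'0)//.
  have : 0 <= 2 * Num.sqrt 2 * Smax.
    by apply: le_trans hB; rewrite addr_ge0 ?mulr_ge0 ?sqrtr_ge0.
  by rewrite pmulr_rge0// mulr_gt0 ?sqrtr_gt0.
have e0 : 0 <= eps / 2 by rewrite divr_ge0// ltW.
rewrite -!mulrA -powRM// ler_pM2l//.
apply: ler_pM; rewrite ?invr_ge0 ?mulr_ge0 ?powR_ge0 ?(ltW aM0)//.
  by rewrite lef_pV2 ?posrE ?mulr_gt0// ler_pM2l.
have -> : enorm s ^+ 3 = (enorm s ^+ 2) `^ (3 / 2).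
  rewrite -powR_mulrn ?enorm_ge0// -powR_mulrn ?enorm_ge0// -powRrM.
  by congr (_ `^ _); field.
by apply: ge0_ler_powR; rewrite ?nnegrE ?sqr_ge0//; exact: mulr_ge0.
Qed.

End Iteration.

(** * Measurability of the quantities in one iteration *)

Section MeasurableAlgorithm.
Context {R : realType} {d : nat}.
Variable f : 'cV[R]_d -> R.
Hypothesis hf : twice_continuously_differentiable f.
Context {disp : measure_display} {T : measurableType disp}.

Lemma measurable_f (X : T -> 'cV[R]_d) : measurable_mx X ->
  measurable_fun setT (fun w => f (X w)).
Proof.
have [df _ _] := hf; move=> mX.
apply: (measurable_continuous_mx (F := f) mX) => y.
exact: (differentiable_continuous (df y)).
Qed.

Lemma measurable_grad (X : T -> 'cV[R]_d) : measurable_mx X ->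
  measurable_mx (fun w => grad f (X w)).
Proof.
have [_ dg _] := hf; move=> mX i j.
apply: (measurable_continuous_mx (F := fun y => grad f y i j) mX) => y.
apply: (continuous_comp (f := grad f) (g := fun M : 'cV[R]_d => M i j)).
  exact: (differentiable_continuous (dg y)).
exact: coord_continuous.
Qed.

Lemma measurable_hess (X : T -> 'cV[R]_d) : measurable_mx X ->
  measurable_mx (fun w => hess f (X w)).
Proof.
have [_ _ ch] := hf; move=> mX i j.
apply: (measurable_continuous_mx (F := fun y => hess f y i j) mX) => y.
apply: (continuous_comp (f := hess f) (g := fun M : 'M[R]_d => M i j)); first exact: ch.
exact: coord_continuous.
Qed.

Variable l : nat.
Variables (X : T -> 'cV[R]_d) (S : T -> 'M[R]_(l, d)).
Hypotheses (mX : measurable_mx X) (mS : measurable_mx S).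

Lemma measurable_qhat (s : T -> 'cV[R]_l) : measurable_mx s ->
  measurable_fun setT (fun w => qhat f (X w) (S w) (s w)).
Proof.
move=> ms; rewrite /qhat.
apply: measurable_funD.
  apply: measurable_funD; first exact: measurable_f.
  by apply: measurable_dot => //; apply: measurable_mx_mul => //; exact: measurable_grad.
apply: measurable_funM => //; apply: measurable_dot => //.
apply: measurable_mx_mul => //; apply: measurable_mx_mul; last exact: measurable_mx_tr.
by apply: measurable_mx_mul => //; exact: measurable_hess.
Qed.

(** The sample space is arbitrary, so that the lemma can be applied to the sigma-algebra generated
    by the past. *)
Lemma measurable_next_iterate (theta : R) (s : T -> 'cV[R]_l) : measurable_mx s ->
  measurable_mx (fun w => if sufficient_decrease f theta (X w) (S w) (s w)
                          then X w + (S w)^T *m s w else X w).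
Proof.
move=> ms i j.
have mXs : measurable_mx (fun w => X w + (S w)^T *m s w).
  by apply: measurable_mxD => //; apply: measurable_mx_mul => //; exact: measurable_mx_tr.
rewrite (_ : (fun w => _) = fun w => if sufficient_decrease f theta (X w) (S w) (s w)
   then (X w + (S w)^T *m s w) i j else X w i j); last first.
  by apply/funext => w; case: ifP.
apply: measurable_fun_ifT; [|exact: mXs|exact: mX].
rewrite /sufficient_decrease; apply: measurable_fun_ler.
  apply: measurable_funM => //; apply: measurable_funB; last exact: measurable_qhat.
  by apply: measurable_qhat; exact: measurable_mx_cst.
by apply: measurable_funB; exact: measurable_f.
Qed.

Lemma measurable_embeds :
  measurable [set w | embeds (S w) (derivative_mx f (X w))].
Proof.
have mM : measurable_mx (fun w => derivative_mx f (X w)).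
  move=> i j; rewrite /derivative_mx.
  case: (splitP (j : 'I_(1 + d))) => k jk.
    rewrite (_ : (fun w => _) = fun w => grad f (X w) i k); first exact: measurable_grad.
    apply/funext => w; rewrite -[RHS](row_mxEl _ (hess f (X w))); congr (row_mx _ _ i _).
    exact: val_inj.
  rewrite (_ : (fun w => _) = fun w => hess f (X w) i k); first exact: measurable_hess.
  apply/funext => w; rewrite -[RHS](row_mxEr (grad f (X w))); congr (row_mx _ _ i _).
  exact: val_inj.
pose F w (z : 'cV[R]_d.+1) : R := dot (S w *m derivative_mx f (X w) *m z) (S w *m derivative_mx f (X w) *m z)
  - (1 - 2^-1) * dot (derivative_mx f (X w) *m z) (derivative_mx f (X w) *m z).
have -> : [set w | embeds (S w) (derivative_mx f (X w))] = [set w | forall z, 0 <= F w z].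
  apply/seteqP; split => w /= h z; have := h z.
    by rewrite !enorm_sqr /F subr_ge0.
  by rewrite !enorm_sqr /F subr_ge0.
have mSM : measurable_mx (fun w => S w *m derivative_mx f (X w)).
  exact: measurable_mx_mul.
apply: measurable_forall_continuous => [z|w].
  apply: measurable_funB.
    by apply: measurable_dot; apply: measurable_mx_mul => //; exact: measurable_mx_cst.
  apply: measurable_funM => //.
  by apply: measurable_dot; apply: measurable_mx_mul => //; exact: measurable_mx_cst.
have c1 : continuous (fun z : 'cV[R]_d.+1 => (1 - 2^-1) *
    dot (derivative_mx f (X w) *m z) (derivative_mx f (X w) *m z)).
  move=> z; apply: (continuous_comp (f := fun z : 'cV[R]_d.+1 =>
    dot (derivative_mx f (X w) *m z) (derivative_mx f (X w) *m z)) (g := *%R (1 - 2^-1)));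
    last exact: mulrl_continuous.
  exact: continuous_dot_mulmx.
move=> z; apply: cvgB; [exact: nbhs_filter|exact: continuous_dot_mulmx|exact: c1].
Qed.

End MeasurableAlgorithm.

(** * Counting successful and bad iterations along one trajectory *)

Section Counting.
Context {R : realType}.
Variables (gamma1 alphamax : R) (p c tau : nat).
Hypothesis hgamma1 : 0 < gamma1 < 1.
Hypothesis halphamax : 0 < alphamax.
Variables (alpha : nat -> R) (succ : nat -> bool).
Hypothesis alpha0 : alpha 0%N = alphamax * gamma1 ^+ p.
Hypothesis alphaS : forall k, alpha k.+1 =
  if succ k then Num.min alphamax (gamma1 ^- c * alpha k) else gamma1 * alpha k.
Hypothesis small_succ :
  forall k, alpha k <= alphamax * gamma1 ^+ (p + tau) -> succ k.

(** [alpha] stays on the lattice [alphamax * gamma1 ^+ m]; truncated subtraction of [c] is exactly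
    the cap at [alphamax]. *)
Fixpoint alpha_exponent k : nat :=
  if k is k'.+1 then
    if succ k' then (alpha_exponent k' - c)%N else (alpha_exponent k').+1
  else p.

Lemma alphaE k : alpha k = alphamax * gamma1 ^+ alpha_exponent k.
Proof.
have [g0 g1] := andP hgamma1.
elim: k => [|k IH] //=; rewrite alphaS IH; case: (succ k); last by rewrite exprS; ring.
set m := alpha_exponent k.
have -> : gamma1 ^- c * (alphamax * gamma1 ^+ m) = alphamax * (gamma1 ^+ m / gamma1 ^+ c).
  by rewrite mulrC -mulrA.
have [cm|/ltnW mc] := leqP c m.
  have -> : gamma1 ^+ m / gamma1 ^+ c = gamma1 ^+ (m - c).
    by rewrite -{1}(subnK cm) exprD mulfK// expf_neq0// gt_eqF.
  rewrite min_r// ler_piMr ?(ltW halphamax)//.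
  by rewrite exprn_ile1// ltW.
have -> : (m - c = 0)%N by apply/eqP; rewrite subn_eq0.
rewrite expr0 mulr1 min_l// ler_peMr ?(ltW halphamax)// ler_pdivlMr ?exprn_gt0// mul1r.
by apply: ler_wiXn2l => //; exact: ltW.
Qed.

(** At exponent [p + tau] success is forced, so the exponent cannot be incremented further. *)
Lemma alpha_exponent_le k : (alpha_exponent k <= p + tau)%N.
Proof.
have [g0 g1] := andP hgamma1.
elim: k => [|k IH] /=; first by rewrite leq_addr.
case: ifPn => [_|ns]; first by apply: leq_trans IH; exact: leq_subr.
rewrite ltn_neqAle IH andbT; apply/eqP => e; move/negP: ns; apply.
by apply: small_succ; rewrite alphaE e.
Qed.

Lemma alpha_bounds k : alphamax * gamma1 ^+ (p + tau) <= alpha k <= alphamax.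
Proof.
have [g0 g1] := andP hgamma1.
rewrite alphaE; apply/andP; split.
  by rewrite ler_pM2l// ler_wiXn2l ?alpha_exponent_le// ltW.
by rewrite ler_piMr ?(ltW halphamax)// exprn_ile1// ltW.
Qed.

(** A failure raises the exponent by 1 and a success lowers it by at most [c]; counting the
    successful iteration itself makes the factor [c.+1]. *)
Lemma success_count k : (k <= c.+1 * \sum_(j < k) succ j + tau)%N.
Proof.
have : (p + k <= alpha_exponent k + c.+1 * \sum_(j < k) succ j)%N.
  elim: k => [|k IH]; first by rewrite big_ord0 /=; lia.
  rewrite big_ord_recr /= mulnDr; move: IH.
  move: (c.+1 * \sum_(j < k) succ j)%N => y.
  by case: (succ k); rewrite ?muln1 ?muln0; lia.
have := alpha_exponent_le k; lia.
Qed.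

Variables (phi : nat -> R) (good : nat -> bool) (h phistar : R).
Hypothesis phi_mono : forall k, phi k.+1 <= phi k.
Hypothesis phi_dec : forall k, succ k -> good k -> h <= phi k - phi k.+1.
Hypothesis phi_lb : forall k, phistar <= phi k.

Lemma decrease_count k :
  h * (\sum_(j < k) (succ j && good j))%N%:R <= phi 0%N - phi k.
Proof.
elim: k => [|k IH]; first by rewrite big_ord0 mulr0 subrr.
rewrite big_ord_recr /= natrD mulrDr.
have := @phi_dec k; have := phi_mono k.
case: (succ k) => /=; case: (good k) => /=; rewrite ?mulr0 ?mulr1; lra.
Qed.

(** A successful iteration is good or bad; the good ones are limited by the total decrease
    available, so many successes force many bad sketches. *)
Lemma bad_count k : 0 < h ->
  (k%:R - tau%:R) / (1 + c%:R) - (\sum_(j < k) ~~ good j)%N%:R <= (phi 0%N - phistar) / h.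
Proof.
move=> h0; set b := (\sum_(j < k) ~~ good j)%N.
set s := (\sum_(j < k) succ j)%N; set g := (\sum_(j < k) (succ j && good j))%N.
have sgb : (s <= g + b)%N.
  rewrite /s /g /b -big_split /=; apply: leq_sum => j _.
  by case: (succ j); case: (good j).
have dc : h * g%:R <= phi 0%N - phistar.
  by apply: le_trans (decrease_count k) _; rewrite lerD2l lerN2.
rewrite ler_pdivlMr//; apply: le_trans dc; rewrite mulrC ler_pM2l//.
rewrite lerBlDr; apply: (@le_trans _ _ s%:R); last by rewrite -natrD ler_nat.
rewrite ler_pdivrMr ?ltr_wpDr// lerBlDr.
have := success_count k; rewrite -(ler_nat R) natrD natrM -natr1 -/s; lra.
Qed.

End Counting.

(** * Freezing the past, and a binomial tail without independence of the bad events *)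

Section Freezing.
Context {R : realType} {disp : measure_display} {T : measurableType disp}.
Variable P : probability T R.
Context {d1 d2 : measure_display} {T1 : measurableType d1} {T2 : measurableType d2}.
Variables (Y1 : T -> T1) (Y2 : T -> T2).
Hypotheses (mY1 : measurable_fun setT Y1) (mY2 : measurable_fun setT Y2).
Hypothesis indep : forall A B, measurable A -> measurable B ->
  P (Y1 @^-1` A `&` Y2 @^-1` B) = (P (Y1 @^-1` A) * P (Y2 @^-1` B))%E.

(* Independence makes the law of [(Y1, Y2)] a product measure, so by Tonelli
   [Y1] can be frozen. *)
Lemma freezing (A : set T1) (Z : set (T1 * T2)) (q : R) :
  measurable A -> measurable Z ->
  (forall y, P [set w | Z (y, Y2 w)] <= q%:E)%E ->
  (P [set w | A (Y1 w) /\ Z (Y1 w, Y2 w)] <= q%:E * P (Y1 @^-1` A))%E.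
Proof.
move=> mA mZ hq.
pose X1 : {mfun T >-> T1} := mfun_Sub (mem_set mY1).
pose X2 : {mfun T >-> T2} := mfun_Sub (mem_set mY2).
have mpair : measurable_fun setT (fun w => (Y1 w, Y2 w)) by exact: measurable_fun_pair.
pose X12 : {mfun T >-> (T1 * T2)%type} := mfun_Sub (mem_set mpair).
have prodE := @product_measure_unique _ _ T1 T2 R (distribution P X1) (distribution P X2)
  (distribution P X12).
have mAZ : measurable ((A `*` setT) `&` Z).
  by apply: measurableI => //; exact: measurableX.
have -> : P [set w | A (Y1 w) /\ Z (Y1 w, Y2 w)] = distribution P X12 ((A `*` setT) `&` Z).
  rewrite /distribution /pushforward /=; congr (P _); apply/seteqP; split => w /=.
    by move=> [? ?]; split.
  by move=> [[? _] ?]; split.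
rewrite -prodE//.
rewrite /product_measure1.
have -> : P (Y1 @^-1` A) = (\int[distribution P X1]_y (\1_A y)%:E)%E.
  by rewrite integral_indic// setIT.
have q0 : 0 <= q by rewrite -lee_fin; apply: le_trans (hq point).
rewrite -ge0_integralZl_EFin//; last exact/measurable_EFinP.
apply: ge0_le_integral => //=.
- exact: measurable_fun_xsection.
- by apply/measurable_EFinP; exact: measurable_funM.
move=> y _; rewrite indicE; have [/set_mem Ay|nAy] := boolP (y \in A).
  rewrite mule1; apply: le_trans (hq y); rewrite le_eqVlt; apply/orP; left; apply/eqP.
  rewrite /distribution /pushforward; congr (P _); apply/seteqP; split => w.
    by rewrite /= /xsection /= inE => -[].
  by rewrite /= /xsection /= inE.
rewrite mule0 (_ : xsection _ _ = set0) ?measure0//.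
by apply/seteqP; split => // z; rewrite /xsection /= inE => -[[/= Ay _] _]; move/negP: nAy; rewrite inE.
Qed.

End Freezing.

Section BinomialTail.
Context {R : realType} {disp : measure_display} {T : measurableType disp}.
Variable P : probability T R.
Variable (bad : nat -> T -> bool) (q : R).
Hypothesis hq : 0 <= q <= 1.
Let count k w := (\sum_(j < k) bad j w)%N.
Hypothesis mcount : forall k j, measurable [set w | (j <= count k w)%N].
Hypothesis mbad : forall k, measurable [set w | bad k w].
Hypothesis freeze : forall k j,
  (P ([set w | count k w = j] `&` [set w | bad k w]) <= q%:E * P [set w | count k w = j])%E.

(** By [freeze], the probability of more than [j] bad events after [k.+1] trials is at most
    [(1 - q)] times that after [k] trials plus [q] times that of at least [j]. The right-hand side
    satisfies this recursion with equality. *)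
Lemma count_tail (a : R) (k j : nat) : 1 <= a ->
  (P [set w | (j <= count k w)%N] <= ((1 - q + q * a) ^+ k / a ^+ j)%:E)%E.
Proof.
move=> a1; have a0 : 0 < a by exact: lt_le_trans a1.
have [q0 q1] := andP hq.
have M1 : 1 <= 1 - q + q * a.
  have : 0 <= q * (a - 1) by rewrite mulr_ge0// subr_ge0.
  lra.
elim: k j => [|k IH] [|j].
- by rewrite !expr0 divr1 probability_le1.
- rewrite (_ : [set w | _] = set0) ?measure0 ?lee_fin ?divr_ge0 ?exprn_ge0 ?(ltW a0)//; first lra.
  by apply/seteqP; split => // w; rewrite /= /count big_ord0.
- rewrite expr0 divr1; apply: le_trans (probability_le1 _ (mcount _ _)) _.
  by rewrite lee_fin exprn_ege1.
have countS w : count k.+1 w = (count k w + bad k w)%N by rewrite /count big_ord_recr.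
pose p1 := fine (P [set w | (j.+1 <= count k w)%N]).
pose p0 := fine (P [set w | (j <= count k w)%N]).
have p1E : P [set w | (j.+1 <= count k w)%N] = p1%:E by rewrite fineK// fin_num_measure.
have p0E : P [set w | (j <= count k w)%N] = p0%:E by rewrite fineK// fin_num_measure.
have eqE : [set w | count k w = j] = [set w | (j <= count k w)%N] `\` [set w | (j.+1 <= count k w)%N].
  apply/seteqP; split => w /=; first by move=> ->; rewrite ltnn; split.
  by move=> [h1 /negP]; rewrite -leqNgt => h2; apply/eqP; rewrite eqn_leq h1 h2.
have meq : measurable [set w | count k w = j] by rewrite eqE; exact: measurableD.
have peq : P [set w | count k w = j] = (p0 - p1)%:E.
  rewrite eqE measureD//; last by rewrite [X in (X < _)%E]p0E ltry.
  rewrite setIidr; last by move=> w /=; exact: ltnW.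
  by rewrite [X in (X - _)%E]p0E [X in (_ - X)%E]p1E.
have step : (P [set w | (j < count k.+1 w)%N] <= p1%:E + q%:E * (p0 - p1)%:E)%E.
  have -> : [set w | (j < count k.+1 w)%N] =
     [set w | (j.+1 <= count k w)%N] `|` ([set w | count k w = j] `&` [set w | bad k w]).
    apply/seteqP; split => w /=; rewrite countS.
      case: (bad k w) => /=; last by rewrite addn0; left.
      rewrite addn1 ltnS leq_eqVlt => /orP[/eqP ->|h]; first by right.
      by left.
    move=> [h|[-> ->]]; last by rewrite addn1.
    by apply: leq_trans h _; exact: leq_addr.
  apply: le_trans (measureU2 P _ _) _ => //; first exact: measurableI.
  apply: leeD; last by rewrite -peq; exact: freeze.
  by rewrite le_eqVlt; apply/orP; left; apply/eqP; exact: p1E.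
apply: le_trans step _; rewrite -EFinM -EFinD lee_fin.
have h1 : p1 <= (1 - q + q * a) ^+ k / a ^+ j.+1 by rewrite -lee_fin -p1E IH.
have h0 : p0 <= (1 - q + q * a) ^+ k / a ^+ j by rewrite -lee_fin -p0E IH.
have -> : (1 - q + q * a) ^+ k.+1 / a ^+ j.+1 =
   (1 - q) * ((1 - q + q * a) ^+ k / a ^+ j.+1) + q * ((1 - q + q * a) ^+ k / a ^+ j).
  by rewrite !exprS; field; rewrite expf_neq0 ?gt_eqF.
have : (1 - q) * p1 <= (1 - q) * ((1 - q + q * a) ^+ k / a ^+ j.+1).
  by rewrite ler_wpM2l//; lra.
have : q * p0 <= q * ((1 - q + q * a) ^+ k / a ^+ j) by rewrite ler_wpM2l.
lra.
Qed.

End BinomialTail.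

(** * The probability that a sketch is good at a fixed point *)

Section GoodEvent.
Context {R : realType}.

Definition opnorm_bound (l d : nat) : R :=
  Num.sqrt (3 / 2) * (1 + Num.sqrt (opnorm_rate l d)).

Lemma opnorm_bound_ge0 l d : 0 <= opnorm_bound l d.
Proof. by rewrite mulr_ge0 ?addr_ge0 ?sqrtr_ge0. Qed.

(** After subadditivity of the root the claim splits into its constant term, the [t] term and the
    [D] term. The last is an equality, which fixes the constant [8/3] in [opnorm_rate]. *)
Lemma opnorm_bound_S_max (l d r : nat) (Cl : R) : (0 < l)%N ->
  l%:R = 4 * Cl * (ln 16 + r%:R + 1) ->
  1 + Num.sqrt 2 * opnorm_bound l d <= 2 * Num.sqrt 2 * S_max d r Cl.
Proof.
move=> l0 hl; rewrite /S_max -hl /opnorm_bound.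
have lR : 0 < l%:R :> R by rewrite ltr0n.
have L16 : 0 < ln 16 :> R := ln16_gt0.
set t : R := Num.sqrt (2 * ln 16) / Num.sqrt l%:R.
set D : R := Num.sqrt d%:R / Num.sqrt l%:R.
have -> : (Num.sqrt d%:R + Num.sqrt (2 * ln 16)) / Num.sqrt l%:R = D + t by rewrite mulrDl.
have t0 : 0 <= t by rewrite divr_ge0 ?sqrtr_ge0.
have D0 : 0 <= D by rewrite divr_ge0 ?sqrtr_ge0.
have r2 : Num.sqrt 2 ^+ 2 = 2 :> R by rewrite sqr_sqrtr.
have r20 : 0 < Num.sqrt 2 :> R by rewrite sqrtr_gt0.
have r3 : Num.sqrt 3 ^+ 2 = 3 :> R by rewrite sqr_sqrtr.
have r30 : 0 < Num.sqrt 3 :> R by rewrite sqrtr_gt0.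
have r8 : Num.sqrt (8 / 3) * Num.sqrt 3 = 2 * Num.sqrt 2 :> R.
  rewrite -sqrtrM; last by rewrite divr_ge0.
  have -> : 8 / 3 * 3 = 2 ^+ 2 * 2 :> R by field.
  by rewrite sqrtrM ?sqr_ge0// sqrtr_sqr ger0_norm.
have -> : Num.sqrt 2 * (Num.sqrt (3 / 2) * (1 + Num.sqrt (opnorm_rate l d))) =
    Num.sqrt 3 * (1 + Num.sqrt (opnorm_rate l d)) :> R.
  by rewrite mulrA -sqrtrM//; congr (Num.sqrt _ * _); field.
have rate : Num.sqrt (opnorm_rate l d) <= t + Num.sqrt (8 / 3) * D :> R.
  have h0 : 0 <= t + Num.sqrt (8 / 3) * D by rewrite addr_ge0 ?mulr_ge0 ?sqrtr_ge0.
  rewrite -[leRHS](ger0_norm h0) -sqrtr_sqr ler_sqrt ?sqr_ge0//.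
  have -> : opnorm_rate l d = t ^+ 2 + (Num.sqrt (8 / 3) * D) ^+ 2 :> R.
    rewrite /t /D !exprMn !exprVn !sqr_sqrtr ?mulr_ge0 ?(ltW L16) ?divr_ge0 ?ler0n//.
    by rewrite /opnorm_rate !mulrA.
  rewrite sqrrD -addrA lerD2l lerDr mulrn_wge0// !mulr_ge0// sqrtr_ge0.
have h3 : 1 + Num.sqrt 3 <= 2 * Num.sqrt 2 :> R.
  rewrite -(@ler_pXn2r _ 2) ?nnegrE ?addr_ge0 ?mulr_ge0 ?(ltW r20) ?(ltW r30)//.
  rewrite sqrrD exprMn r2 r3 expr1n mul1r.
  have : Num.sqrt 3 <= 2 :> R.
    by rewrite -(@ler_pXn2r _ 2) ?nnegrE ?(ltW r30)// r3; lra.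
  lra.
have h4 : Num.sqrt 3 * Num.sqrt (opnorm_rate l d) <= Num.sqrt 3 * t + 2 * Num.sqrt 2 * D :> R.
  by rewrite -r8 [_ * Num.sqrt 3]mulrC -mulrA -mulrDr ler_pM2l.
have h5 : Num.sqrt 3 * t <= 2 * Num.sqrt 2 * t :> R by rewrite ler_wpM2r//; lra.
lra.
Qed.

Lemma rank_derivative_mx (d r : nat) (f : 'cV[R]_d -> R) (x : 'cV[R]_d) :
  (\rank (hess f x) <= r)%N -> (\rank (derivative_mx f x) <= r.+1)%N.
Proof.
move=> hr.
have h : (\rank (col_mx (grad f x)^T (hess f x)^T) <= r.+1)%N.
  rewrite -addsmxE; apply: leq_trans (mxrank_adds_leqif _ _) _.
  by apply: (@leq_add _ _ 1 r); [exact: rank_leq_row|rewrite mxrank_tr].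
by move: h; rewrite -tr_row_mx mxrank_tr.
Qed.

Definition good_sketch (l d : nat) (f : 'cV[R]_d -> R) (x : 'cV[R]_d) (S : 'M[R]_(l, d)) : Prop :=
  embeds S (derivative_mx f x) /\ norm_bounded S (opnorm_bound l d).

Context {disp : measure_display} {T : measurableType disp}.

Lemma measurable_good_sketch (l d : nat) (f : 'cV[R]_d -> R)
    (X : T -> 'cV[R]_d) (S : T -> 'M[R]_(l, d)) :
  twice_continuously_differentiable f -> measurable_mx X -> measurable_mx S ->
  measurable [set w | good_sketch f (X w) (S w)].
Proof.
move=> hf mX mS; rewrite (_ : [set w | _] = [set w | embeds (S w) (derivative_mx f (X w))]
  `&` [set w | norm_bounded (S w) (opnorm_bound l d)]); last by apply/seteqP; split.
apply: measurableI; first exact: measurable_embeds.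
by apply: measurable_opnorm_event => //; exact: opnorm_bound_ge0.
Qed.

Lemma good_sketch_probability (P : probability T R) (l d r : nat)
    (f : 'cV[R]_d -> R) (x : 'cV[R]_d) (S : T -> 'M[R]_(l, d)) (Cl : R) :
  twice_continuously_differentiable f -> gaussian_embedding_constant Cl ->
  (0 < l)%N -> l%:R = 4 * Cl * (ln 16 + r%:R + 1) ->
  (\rank (hess f x) <= r)%N -> scaled_gaussian P S ->
  (P [set w | ~ good_sketch f x (S w)] <= (1 / 8)%:E)%E.
Proof.
move=> hf [Cl0 hCl] l0 hl hr gS; have [mS _ _] := gS.
have := hCl _ _ P l d r S (derivative_mx f x) 2^-1 l0 _ _ (rank_derivative_mx hr) gS.
have L16 : 0 < ln 16 :> R := ln16_gt0.
(* With distortion 1/2, the choice of [l] cancels [r + 1] in the exponent and leaves failure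
   probability [1/16]. *)
have -> : - (l%:R * 2^-1 ^+ 2 / Cl) + r%:R + 1 = - ln 16 :> R.
  by rewrite hl; field; rewrite gt_eqF.
rewrite expRN lnK ?posrE// => hA.
have {}hA : ((1 - 16^-1)%:E <= P [set w | embeds (S w) (derivative_mx f x)])%E.
  by apply: hA; lra.
have hB := scaled_gaussian_opnorm l0 gS; rewrite -/(opnorm_bound l d) in hB.
set A := [set w | embeds _ _] in hA.
pose B := [set w | norm_bounded (S w) (opnorm_bound l d)].
have mA : measurable A by apply: (measurable_embeds hf (X := fun=> x)) => //; exact: measurable_mx_cst.
have mB : measurable B by apply: measurable_opnorm_event => //; exact: opnorm_bound_ge0.
have -> : [set w | ~ good_sketch f x (S w)] = ~` A `|` ~` B.
  by rewrite -setCI; apply/seteqP; split.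
have compl (C : set T) : measurable C -> ((1 - 16^-1)%:E <= P C)%E ->
    (P (~` C) <= (16^-1)%:E)%E.
  move=> mC; rewrite probability_setC// -(fineK (fin_num_measure P _ mC)).
  by rewrite -EFinB !lee_fin; lra.
apply: le_trans (measureU2 P _ _) _; [exact: measurableC|exact: measurableC|].
apply: (@le_trans _ _ ((16^-1)%:E + (16^-1)%:E)%E); last by rewrite -EFinD lee_fin; lra.
by apply: leeD; exact: compl.
Qed.

End GoodEvent.

(** * The sigma-algebra of the past *)

Section GeneratedSigmaAlgebras.
Context {R : realType} {disp : measure_display} {T : measurableType disp}.
Implicit Types G : set (set T).

(** The carrier [T] is kept and only its sigma-algebra replaced, so results for arbitrary sample
    spaces apply unchanged. *)
Definition gen_measurable_mx G (m n : nat) (X : T -> 'M[R]_(m, n)) : Prop :=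
  @measurable_mx R _ (g_sigma_algebraType G) m n X.

Lemma gen_measurable_mono G G' (m n : nat) (X : T -> 'M[R]_(m, n)) :
  G `<=` G' -> gen_measurable_mx G X -> gen_measurable_mx G' X.
Proof.
move=> GG' mX i j _ B mB; apply: (sub_smallest2r _ GG').
  exact: smallest_sigma_algebra.
by have := mX i j measurableT B mB.
Qed.

Lemma gen_measurable_mx_events G (m n : nat) (X : T -> 'M[R]_(m, n)) :
  mx_events X `<=` G -> gen_measurable_mx G X.
Proof.
move=> XG i j _ B mB; apply: sub_sigma_algebra; apply: XG.
by exists i, j; exists B.
Qed.

Lemma gen_sub_measurable G (A : set T) :
  G `<=` measurable -> <<s G >> A -> measurable A.
Proof.
move=> Gm; apply: smallest_sub => //; exact: sigma_algebra_measurable.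
Qed.

Lemma mx_events_measurable (m n : nat) (X : T -> 'M[R]_(m, n)) :
  measurable_mx X -> mx_events X `<=` measurable.
Proof. by move=> mX _ [i [j [B mB <-]]]; exact: mX. Qed.

End GeneratedSigmaAlgebras.

Section Run.
Context {R : realType} {disp : measure_display} {T : measurableType disp}.
Variables (P : probability T R) (d l : nat) (f : 'cV[R]_d -> R).
Hypothesis hf : twice_continuously_differentiable f.
Variables (theta : R) (S : nat -> T -> 'M[R]_(l, d)) (shat : nat -> T -> 'cV[R]_l)
  (x : nat -> T -> 'cV[R]_d) (x0 : 'cV[R]_d).
Hypothesis x_init : forall w, x 0%N w = x0.
Hypothesis x_step : forall k w, x k.+1 w =
  if sufficient_decrease f theta (x k w) (S k w) (shat k w)
  then x k w + (S k w)^T *m shat k w else x k w.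
Hypothesis mS : forall k, measurable_mx (S k).
Hypothesis ms : forall k, measurable_mx (shat k).

Let past k : set (set T) := \bigcup_(j in [set j | (j < k)%N])
  (mx_events (S j) `|` mx_events (shat j)).

Let past_mono j k : (j <= k)%N -> past j `<=` past k.
Proof. by move=> jk A [i /= ij Ai]; exists i => //=; exact: leq_trans jk. Qed.

Let past_measurable k : past k `<=` measurable.
Proof. by move=> A [i _ [|]]; apply: mx_events_measurable. Qed.

Let past_S j k : (j < k)%N -> gen_measurable_mx (past k) (S j).
Proof. by move=> jk; apply: gen_measurable_mx_events => A; exists j => //; left. Qed.

Let past_s j k : (j < k)%N -> gen_measurable_mx (past k) (shat j).
Proof. by move=> jk; apply: gen_measurable_mx_events => A; exists j => //; right. Qed.

Lemma past_x j k : (j <= k)%N -> gen_measurable_mx (past k) (x j).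
Proof.
move=> jk; apply: (gen_measurable_mono (past_mono jk)) => {k jk}.
elim: j => [|j IH].
  by rewrite (_ : x 0%N = fun=> x0); [exact: measurable_mx_cst|exact/funext].
rewrite (_ : x j.+1 = fun w => if sufficient_decrease f theta (x j w) (S j w) (shat j w)
  then x j w + (S j w)^T *m shat j w else x j w); last exact/funext.
apply: (@measurable_next_iterate _ _ _ hf _ (g_sigma_algebraType (past j.+1))).
- exact: (gen_measurable_mono (past_mono (leqnSn j))).
- exact: past_S.
- exact: past_s.
Qed.

Lemma measurable_x k : measurable_mx (x k).
Proof.
move=> i j _ B mB; apply: (gen_sub_measurable (@past_measurable k)).
exact: (past_x (leqnn k) i j measurableT mB).
Qed.

Definition bad_iteration k w : bool := ~~ `[< good_sketch f (x k w) (S k w) >].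

Hypothesis indep : forall k, independent_sigma P (mx_events (S k)) (past k).
Variable q : R.
Hypothesis badq : forall k y, (P [set w | ~ good_sketch f (x k y) (S k w)] <= q%:E)%E.

Let past_bad j k : (j < k)%N -> <<s past k >> [set w | bad_iteration j w].
Proof.
move=> jk.
have -> : [set w | bad_iteration j w] = ~` [set w | good_sketch f (x j w) (S j w)].
  apply/seteqP; split => w /=; rewrite /bad_iteration; first by move/asboolPn.
  by move=> h; apply/asboolPn.
apply: (@measurableC _ (g_sigma_algebraType (past k))).
apply: (@measurable_good_sketch _ _ (g_sigma_algebraType (past k))) => //.
- exact: past_x (ltnW jk).
- exact: past_S.
Qed.

Let count k w := (\sum_(j < k) bad_iteration j w)%N.

Let past_count k j : <<s past k >> [set w | (j <= count k w)%N].
Proof.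
(* The count is treated as a real sum of indicators, for which measurability of finite sums is at
   hand. *)
have mc : @measurable_fun _ _ (g_sigma_algebraType (past k)) R setT
    (fun w => \sum_(i < k) \1_[set w | bad_iteration i w] w).
  apply: measurable_sum => i; apply: measurable_indic.
  exact: past_bad.
have -> : [set w | (j <= count k w)%N] =
   [set w | j%:R <= \sum_(i < k) \1_[set w | bad_iteration i w] w :> R].
  have cE w : (count k w)%:R = \sum_(i < k) \1_[set w | bad_iteration i w] w :> R.
    rewrite natr_sum; apply: eq_bigr => i _; rewrite indicE.
    by congr (nat_of_bool _)%:R; apply/idP/idP; rewrite inE.
  by apply/seteqP; split => w /=; rewrite -cE ler_nat.
have mle := measurable_fun_ler (f := fun=> j%:R) (measurable_cst _) mc.
have m1 : measurable [set true] by [].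
by have := mle measurableT _ m1; rewrite setTI.
Qed.

Lemma measurable_bad_count k j :
  measurable [set w | (j <= \sum_(i < k) bad_iteration i w)%N].
Proof. exact: (gen_sub_measurable (@past_measurable k) (@past_count k j)). Qed.

Lemma measurable_min_grad (eps : R) (N : nat) : 0 <= eps ->
  measurable [set w | \big[Num.min/enorm (grad f (x 1%N w))]_(k < N.+1)
                        enorm (grad f (x k.+1 w)) <= eps].
Proof.
move=> eps0.
have -> : [set w | \big[Num.min/enorm (grad f (x 1%N w))]_(k < N.+1)
    enorm (grad f (x k.+1 w)) <= eps] =
  ~` \bigcap_(k in [set: 'I_N.+1])
      [set w | eps ^+ 2 < dot (grad f (x k.+1 w)) (grad f (x k.+1 w))].
  have sqE v : (eps < enorm v) = (eps ^+ 2 < dot v v) :> bool.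
    by rewrite -enorm_sqr ltr_pXn2r// nnegrE enorm_ge0.
  apply/seteqP; split => w /=.
    (* The default value of the iterated minimum is its own term of index 0, so it changes
       nothing. *)
    rewrite leNgt => /negP h hall; apply: h; apply/bigmin_gtP; split => [|k _].
      by rewrite sqE; exact: (hall ord0).
    by rewrite sqE; exact: (hall k).
  move=> h; rewrite leNgt; apply/negP => /bigmin_gtP[_ hall]; apply: h => k _ /=.
  by rewrite -sqE; exact: hall.
apply: measurableC; apply: fin_bigcap_measurable => // k _.
rewrite -[X in measurable X]setTI.
have mg := measurable_grad hf (measurable_x (k.+1)).
have mf := measurable_fun_ltr (f := fun=> eps ^+ 2) (measurable_cst _) (measurable_dot mg mg).
exact: (mf measurableT [set true]).
Qed.

Lemma bad_count_tail (a : R) (k j : nat) : 0 <= q <= 1 -> 1 <= a ->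
  (P [set w | (j <= count k w)%N] <= ((1 - q + q * a) ^+ k / a ^+ j)%:E)%E.
Proof.
move=> q01 a1; apply: count_tail => //.
- by move=> k' j'; exact: gen_sub_measurable (past_count _ _).
- by move=> k'; exact: gen_sub_measurable (past_bad (ltnSn k')).
move=> k' j'.
(* Both maps to be frozen are the identity of [T], once with the past and once with the events of
   the sketch. In the product, the iterate is read at one point and the sketch at the other. *)
pose T1 := g_sigma_algebraType (past k').
pose T2 := g_sigma_algebraType (mx_events (S k')).
have m1 : measurable_fun setT (idfun : T -> T1).
  by move=> _ A mA; rewrite setTI; exact: gen_sub_measurable mA.
have m2 : measurable_fun setT (idfun : T -> T2).
  by move=> _ A mA; rewrite setTI; apply: gen_sub_measurable mA; exact: mx_events_measurable.
have ind (A : set T1) (B : set T2) : measurable A -> measurable B ->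
    P ((idfun : T -> T1) @^-1` A `&` (idfun : T -> T2) @^-1` B) =
    (P ((idfun : T -> T1) @^-1` A) * P ((idfun : T -> T2) @^-1` B))%E.
  by move=> mA mB; rewrite setIC muleC; exact: (@indep k' B A mB mA).
pose A : set T1 := [set w | count k' w = j'].
have mA : measurable A.
  rewrite (_ : A = [set w | (j' <= count k' w)%N] `\` [set w | (j'.+1 <= count k' w)%N]).
    by apply: measurableD; exact: past_count.
  apply/seteqP; split => w; rewrite /A /=; first by move=> ->; rewrite ltnn; split.
  by move=> [h1 /negP]; rewrite -leqNgt => h2; apply/eqP; rewrite eqn_leq h1 h2.
pose Z : set (T1 * T2) := ~` [set z | good_sketch f (x k' z.1) (S k' z.2)].
have mZ : measurable Z.
  apply: measurableC; apply: measurable_good_sketch => //.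
    move=> i i'; apply: (measurableT_comp (f := fun w : T1 => x k' w i i')) => //.
    exact: past_x.
  move=> i i'; apply: (measurableT_comp (f := fun w : T2 => S k' w i i')) => //.
  exact: (gen_measurable_mx_events (G := mx_events (S k'))).
have := freezing m1 m2 ind mA mZ (badq k').
apply: le_trans; rewrite le_eqVlt; apply/orP; left; apply/eqP; congr (P _).
apply/seteqP; split => w /=; rewrite /A /Z /bad_iteration /=.
  by move=> [h1 /asboolPn h2]; split.
by move=> [h1 h2]; split => //; apply/asboolPn.
Qed.

End Run.

(** * The Chernoff exponent and positivity of the constants *)

Section Assembly.
Context {R : realType}.

(** Squaring [exp (t/2) <= 1 / (1 - t/2)] suffices. The constant [7/2] is what the target exponent
    allows: [(delta + 7/2 delta^2) / 8 - delta (1/8 + 7/8 delta) = - 7/16 delta^2]. *)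
Lemma expR_le_quadratic (t : R) : 0 <= t <= 1 -> expR t <= 1 + t + 7 / 2 * t ^+ 2.
Proof.
move=> /andP[t0 t1].
have h := expR_ge1Dx (- (t / 2)).
have e0 : 0 < expR (t / 2) := expR_gt0 _.
have em : expR (t / 2) * expR (- (t / 2)) = 1 by rewrite -expRD subrr expR0.
have -> : expR t = expR (t / 2) ^+ 2 by rewrite expr2 -expRD; congr expR; field.
have h1 : expR (t / 2) * (1 - t / 2) <= 1 by rewrite -[leRHS]em ler_pM2l.
have u0 : 0 < 1 - t / 2 by lra.
have h2 : (expR (t / 2) * (1 - t / 2)) ^+ 2 <= 1.
  by rewrite exprn_ile1// mulr_ge0// ltW.
rewrite -(ler_pM2r (_ : 0 < (1 - t / 2) ^+ 2)) ?exprn_gt0// -exprMn.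
apply: le_trans h2 _; rewrite -subr_ge0.
have -> : (1 + t + 7 / 2 * t ^+ 2) * (1 - t / 2) ^+ 2 - 1 =
   t ^+ 2 * (11 / 4 - 13 / 4 * t + 7 / 8 * t ^+ 2) by field.
by apply: mulr_ge0; [exact: sqr_ge0|nra].
Qed.

(* The Chernoff parameter is [delta] itself. *)
Lemma chernoff_exponent (delta : R) (N j : nat) : 0 < delta < 1 ->
  N%:R * (1 / 8 + 7 / 8 * delta) <= j%:R ->
  (1 - 1 / 8 + 1 / 8 * expR delta) ^+ N / expR delta ^+ j
    <= expR (- (7 * delta ^+ 2 / 16 * N%:R)).
Proof.
move=> /andP[d0 d1] hj.
have hq : expR delta <= 1 + delta + 7 / 2 * delta ^+ 2.
  by apply: expR_le_quadratic; rewrite !ltW.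
have hM : 1 - 1 / 8 + 1 / 8 * expR delta <= expR ((delta + 7 / 2 * delta ^+ 2) / 8).
  by apply: le_trans (expR_ge1Dx _); lra.
have M0 : 0 <= 1 - 1 / 8 + 1 / 8 * expR delta.
  by have := expR_ge0 delta; lra.
rewrite ler_pdivrMr ?exprn_gt0 ?expR_gt0// -!expRM_natl -expRD.
apply: (@le_trans _ _ (expR ((delta + 7 / 2 * delta ^+ 2) / 8) ^+ N)).
  by apply: lerXn2r; rewrite ?nnegrE ?expR_ge0.
rewrite -expRM_natl ler_expR.
have : N%:R * (1 / 8 + 7 / 8 * delta) * delta <= j%:R * delta by rewrite ler_pM2r.
lra.
Qed.

Lemma h_rarc_gt0 (theta alphamax LH Smax kappaT eps a : R) :
  0 < theta -> 0 < alphamax -> 0 < LH -> 0 < Smax -> 0 <= kappaT -> 0 < eps -> 0 < a ->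
  0 < h_rarc theta alphamax LH Smax kappaT eps a.
Proof.
move=> t0 M0 L0 S0 k0 e0 a0.
have D0 : 0 < 1 / a * Smax + kappaT by rewrite ltr_wpDr// mulr_gt0// divr_gt0.
apply: mulr_gt0; first by rewrite mulr_gt0 ?powR_gt0 ?divr_gt0 ?mulr_gt0.
by rewrite lt_min divr_gt0 ?powR_gt0//= divr_gt0 ?sqrtr_gt0 ?divr_gt0.
Qed.

Lemma S_max_ge1 (d r : nat) (Cl : R) : 1 <= S_max d r Cl.
Proof. by rewrite lerDl divr_ge0 ?addr_ge0 ?sqrtr_ge0. Qed.

End Assembly.

(** * From a trajectory with large gradients to many bad sketches, and the conclusion *)

Section Trajectory.
Context {R : realType} {disp : measure_display} {T : measurableType disp}.
Variables (P : probability T R) (d l r : nat) (f : 'cV[R]_d -> R) (fstar LH eps : R).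
Hypothesis hfstar : forall z, fstar <= f z.
Hypothesis hf : twice_continuously_differentiable f.
Hypothesis hLH : 0 < LH.
Hypothesis hLip : lipschitz_hessian f LH.
Hypothesis heps : 0 < eps.
Variable Cl : R.
Hypothesis hl0 : (0 < l)%N.
Hypothesis hl : l%:R = 4 * Cl * (ln 16 + r%:R + 1).
Variables (gamma1 gamma2 theta kappaT alphamax alpha0 : R) (c p : nat) (x0 : 'cV[R]_d).
Hypothesis hgamma1 : 0 < gamma1 < 1.
Hypothesis hgamma2 : gamma2 = gamma1 ^- c.
Hypothesis htheta : 0 < theta < 1.
Hypothesis hkappaT : 0 <= kappaT.
Hypothesis halphamax : 0 < alphamax.
Hypothesis halpha0 : alpha0 = alphamax * gamma1 ^+ p.
Variables (S : nat -> T -> 'M[R]_(l, d)) (shat : nat -> T -> 'cV[R]_l)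
  (x : nat -> T -> 'cV[R]_d) (alpha : nat -> T -> R).
Hypothesis hrun : rarc_run P f (scaled_gaussian P) gamma1 gamma2 theta kappaT
            alphamax alpha0 x0 S shat x alpha.
Variable tau : nat.
Hypothesis halphalow : alpha0 * gamma1 ^+ tau <= 2 * (1 - theta) / LH.

(** The deterministic half of the argument, for one outcome [w]; randomness enters only through the
    number of bad iterations. *)
Lemma run_bad_count (N : nat) (w : T) :
  (forall k, (k <= N)%N -> eps < enorm (grad f (x k.+1 w))) ->
  (N%:R - tau%:R) / (1 + c%:R) - (\sum_(j < N) bad_iteration f S x j w)%N%:R
    <= (f x0 - fstar) / h_rarc theta alphamax LH (S_max d r Cl) kappaT eps
                          (alpha0 * gamma1 ^+ (c + tau)).
Proof.
move=> hgrad.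
have [g0 g1] := andP hgamma1; have [t0 t1] := andP htheta.
have [hx0 ha0 _ _ _ _ hdec hstat hx ha] := hrun.
pose succ k := sufficient_decrease f theta (x k w) (S k w) (shat k w).
have aS k : alpha k.+1 w = if succ k then Num.min alphamax (gamma1 ^- c * alpha k w)
    else gamma1 * alpha k w by rewrite ha -hgamma2.
have aE := alphaE hgamma1 halphamax (etrans (ha0 w) halpha0) aS.
have abnd k : 0 < alpha k w <= alphamax.
  rewrite aE mulr_gt0 ?exprn_gt0//= ler_piMr ?(ltW halphamax)//.
  by rewrite exprn_ile1// ltW.
have small k : alpha k w <= alphamax * gamma1 ^+ (p + tau) -> succ k.
  move=> hk; apply: (small_alpha_success hf hLH hLip htheta (abnd k) (hdec k w)).
  by apply: le_trans hk _; rewrite exprD mulrA -halpha0.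
have amin := alpha_bounds hgamma1 halphamax (etrans (ha0 w) halpha0) aS small.
(* Lying below every [alpha k w], this value gives one decrease [h] valid at all iterations. *)
set a' := alpha0 * gamma1 ^+ (c + tau).
set h := h_rarc _ _ _ _ _ _ a'.
have a0 : 0 < alpha0 by rewrite halpha0 mulr_gt0 ?exprn_gt0.
have a'0 : 0 < a' by rewrite mulr_gt0 ?exprn_gt0.
have a'min : a' <= alpha0 * gamma1 ^+ tau.
  by rewrite /a' ler_pM2l// ler_wiXn2l ?leq_addl// ltW.
have a'k k : 0 < a' <= alpha k w.
  rewrite a'0 (le_trans a'min)//; have /andP[+ _] := amin k.
  by rewrite exprD mulrA -halpha0.
have La' : LH / 2 <= a'^-1.
  rewrite -[LH / 2]invrK lef_pV2 ?posrE ?invr_gt0 ?divr_gt0// invf_div.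
  apply: le_trans a'min _; apply: le_trans halphalow _.
  by rewrite ler_pM2r ?invr_gt0//; lra.
have Smax0 : 0 < S_max d r Cl by apply: lt_le_trans (S_max_ge1 _ _ _).
have h0 : 0 < h by exact: h_rarc_gt0.
(* The counting lemma asks for the decrease at all indices, while the gradients are known to be
   large only up to [N]. *)
pose good j := (j <= N)%N && `[< good_sketch f (x j w) (S j w) >].
have mono k : f (x k.+1 w) <= f (x k w).
  rewrite hx; case: ifPn => // hs.
  exact: (success_monotone htheta (abnd k) (hdec k w) hs).
have dec k : succ k -> good k -> h <= f (x k w) - f (x k.+1 w).
  move=> hs /andP[kN /asboolP[hemb hnorm]].
  have xS : x k.+1 w = x k w + (S k w)^T *m shat k w by rewrite hx -/(succ k) hs.
  rewrite xS.
  apply: (success_decrease hf hLH hLip htheta hkappaT (abnd k) (hdec k w) (hstat k w) heps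
    (a'k k) La' hemb hnorm (opnorm_bound_ge0 l d) (opnorm_bound_S_max _ hl0 hl) _ hs).
  by rewrite -xS; exact: hgrad.
have := bad_count hgamma1 halphamax (etrans (ha0 w) halpha0) aS small mono dec
  (fun k => hfstar (x k w)) N h0.
rewrite hx0; congr (_ - _%:R <= _).
apply: eq_bigr => j _; rewrite /good /bad_iteration ltnW ?ltn_ord//.
Qed.

End Trajectory.

Theorem theorem5p3p1 (R : realType)
  (disp : measure_display) (T : measurableType disp) (P : probability T R)
  (d l r : nat)
  (f : 'cV[R]_d -> R) (fstar LH eps : R)
  (hfstar : forall z, fstar <= f z)
  (hf : twice_continuously_differentiable f)
  (hLH : 0 < LH)
  (hLip : lipschitz_hessian f LH)
  (heps : 0 < eps)
  (Cl : R) (hCl : gaussian_embedding_constant Cl)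
  (hl0 : (0 < l)%N)
  (hl : l%:R = 4 * Cl * (ln 16 + r%:R + 1))
  (gamma1 gamma2 theta kappaT alphamax alpha0 : R) (c p : nat) (x0 : 'cV[R]_d)
  (hgamma1 : 0 < gamma1 < 1)
  (hc : (0 < c)%N) (hgamma2 : gamma2 = gamma1 ^- c)
  (htheta : 0 < theta < 1) (hkappaT : 0 <= kappaT) (halphamax : 0 < alphamax)
  (hp : (0 < p)%N) (halpha0 : alpha0 = alphamax * gamma1 ^+ p)
  (S : nat -> T -> 'M[R]_(l, d)) (shat : nat -> T -> 'cV[R]_l)
  (x : nat -> T -> 'cV[R]_d) (alpha : nat -> T -> R)
  (hrun : rarc_run P f (scaled_gaussian P) gamma1 gamma2 theta kappaT
            alphamax alpha0 x0 S shat x alpha)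
  (hrank : forall k w, (\rank (hess f (x k w)) <= r)%N)
  (hc8 : 1 / 8 < c%:R / (c%:R + 1) ^+ 2 :> R)
  (tau : nat) (htau : (0 < tau)%N)
  (halphalow : alpha0 * gamma1 ^+ tau <= 2 * (1 - theta) / LH)
  (halphamin : alpha0 * gamma1 ^+ tau <= alpha0 / gamma2)
  (delta1 : R) (hdelta1 : 0 < delta1 < 1) (hg : 0 < g_rarc c delta1)
  (N : nat)
  (hN : g_rarc c delta1 *
          ((f x0 - fstar) / h_rarc theta alphamax LH (S_max d r Cl) kappaT eps
                              (alpha0 * gamma1 ^+ (c + tau))
           + tau%:R / (1 + c%:R)) <= N%:R) :
  ((1 - expR (- (7 * delta1 ^+ 2 / 16 * N%:R)))%:E <=
   P [set w | (\big[Num.min/enorm (grad f (x 1%N w))]_(k < N.+1)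
                enorm (grad f (x k.+1 w)) <= eps)%R])%E.
Proof.
have [hx0 _ hlaw mS ms hind _ _ hx _] := hrun.
have [d0 d1] := andP hdelta1.
(* For [N = 0] the claimed bound is 0; the final strict inequality needs [N > 0]. *)
have [->|N0] := eqVneq N 0%N; first by rewrite mulr0 oppr0 expR0 subrr measure_ge0.
pose count w := (\sum_(j < N) bad_iteration f S x j w)%N.
(* Floor plus one: [j] is above the threshold, as the Chernoff bound requires, and a count below [j]
   is at most the floor, hence within the threshold. *)
pose j := (Num.truncn (N%:R * (1 / 8 + 7 / 8 * delta1) : R)).+1.
have b0 : 0 <= N%:R * (1 / 8 + 7 / 8 * delta1) :> R by rewrite mulr_ge0//; lra.
have /andP[j1 j2] := truncn_itv b0; rewrite -/j in j2.
have tail : (P [set w | (j <= count w)%N] <= (expR (- (7 * delta1 ^+ 2 / 16 * N%:R)))%:E)%E.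
  apply: le_trans (bad_count_tail hf hx0 hx mS ms hind _ (q := 1 / 8) (a := expR delta1) N j _ _) _.
  - by move=> k y; apply: (good_sketch_probability hf hCl hl0 hl (hrank k y) (hlaw k)).
  - by lra.
  - by rewrite -expR0 ler_expR ltW.
  by rewrite lee_fin; apply: chernoff_exponent => //; exact: ltW.
have mcount : measurable [set w | (j <= count w)%N].
  exact: (measurable_bad_count hf hx0 hx mS ms).
apply: (@le_trans _ _ (P (~` [set w | (j <= count w)%N]))).
  rewrite probability_setC//; move: tail.
  rewrite -(fineK (fin_num_measure P _ mcount)) -EFinB !lee_fin; lra.
have mE : measurable [set w | \big[Num.min/enorm (grad f (x 1%N w))]_(k < N.+1)
                enorm (grad f (x k.+1 w)) <= eps].
  exact: (measurable_min_grad hf hx0 hx mS ms N (ltW heps)).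
apply: le_measure; rewrite ?inE//; first exact: measurableC.
move=> w /= /negP; rewrite -ltnNge ltnS => hcount.
rewrite leNgt; apply/negP => /bigmin_gtP[_ hgrad].
have := run_bad_count hfstar hf hLH hLip heps hl0 hl hgamma1 hgamma2 htheta hkappaT halphamax
  halpha0 hrun halphalow (N := N) (w := w).
have -> : (\sum_(j < N) bad_iteration f S x j w)%N = count w by [].
set q := (f x0 - fstar) / _ in hN *.
move=> /(_ (fun k kN => hgrad (Ordinal (kN : (k < N.+1)%N)) isT)).
have cN : (count w)%:R <= N%:R * (1 / 8 + 7 / 8 * delta1) :> R.
  by apply: le_trans j1; rewrite ler_nat.
have Np : 0 < N%:R :> R by rewrite ltr0n lt0n.
have c0 : 0 < c%:R :> R by rewrite ltr0n.
move: hN hg; rewrite /g_rarc invr_gt0 => hN' hg'.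
rewrite ler_pdivrMl// in hN'.
(* Adding the bound on the count to [hN'] cancels every term except
   [N / (1 + c) <= N * c / (c + 1)^2], which this inequality contradicts. *)
have hcc : c%:R / (c%:R + 1) ^+ 2 < (1 + c%:R)^-1 :> R.
  rewrite -subr_gt0.
  have -> : (1 + c%:R)^-1 - c%:R / (c%:R + 1) ^+ 2 = (c%:R + 1) ^- 2 :> R.
    by field; rewrite gt_eqF//; lra.
  by rewrite invr_gt0 exprn_gt0//; lra.
have := hcc; rewrite -(ltr_pM2l Np) mulrBl; lra.
Qed.
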